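(* Let $c_0,\delta_0>0$ and let $a\in[0,1]^{\mathbb{Z}}$ be an irreducible, aperiodic sequence. There are $c,C\in(0,+\infty)$, $\lambda_0\geq 0$ and $n_0\geq 1$ such that the following holds. For any $n\geq n_0$, any $\sqrt n\geq\lambda\geq\lambda_0$, any independent sequence $X_1,\dots,X_n$ of random variables with laws in $\mathcal{M}_{\delta_0,c_0}^a$, and any $0\leq u,v\leq\lambda$, $$P_u\bigl(0\leq\min_{i=1,\dots,n}\bar S_i,\ \max_{i=1,\dots,n}\bar S_i\leq\lambda,\ \bar S_n=v\bigr)\leq\frac{C(\min(u,\lambda-u)+1)(\min(v,\lambda-v)+1)}{\lambda^3}\exp\Bigl(-\frac{cn}{\lambda^2}\Bigr).$$
   Context: Here $u,v$ are real. Write $\bar X_i=X_i-E(X_i)$. Under $P_u$, $\bar S_0=u$ and $\bar S_k=u+\bar X_1+\dots+\bar X_k$. $\mathcal{M}_{\mathbb{Z}}$ is the set of probability measures on $\mathbb{Z}$; $p(i)$ is the mass of $p$ at $i$. A measure $p\in\mathcal{M}_{\mathbb{Z}}$ is called irreducible (resp. aperiodic) if the random walk on $\mathbb{Z}$ with i.i.d. steps of law $p$ is an irreducible (resp. aperiodic) Markov chain. A sequence $a=(a_i)_{i\in\mathbb{Z}}\in[0,1]^{\mathbb{Z}}$ is irreducible and aperiodic if there are an irreducible and aperiodic $p\in\mathcal{M}_{\mathbb{Z}}$ and numbers $b_i>0$, $i\in\mathbb{Z}$, with $a_i=b_ip(i)$ for all $i$. For $\delta,c>0$, $$\mathcal{M}_{\delta,c}^a=\Bigl\{p\in\mathcal{M}_{\mathbb{Z}}:\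 \sup_{|t|\leq\delta}\sum_{k\in\mathbb{Z}}p(k)e^{tk}\leq c,\ p(i)\geq a_i\ \forall i\in\mathbb{Z}\Bigr\}.$$ *)

(* Defs.v *)
From HB Require Import structures.
From mathcomp Require Import all_boot all_order all_algebra.
From mathcomp Require Import all_classical all_reals all_analysis.
Set Implicit Arguments.
Unset Strict Implicit.
Unset Printing Implicit Defensive.
Import Order.TTheory GRing.Theory Num.Theory.
Import numFieldNormedType.Exports.
Local Open Scope classical_set_scope.
Local Open Scope ring_scope.

(* The integers carry the discrete sigma-algebra, as nat does in the library,
   so that [probability int R] is the type of probability measures on Z. *)
HB.instance Definition _ := isPointed.Build int 0.
HB.instance Definition _ := @isMeasurable.Build default_measure_display
  int discrete_measurable discrete_measurable0
  discrete_measurableC discrete_measurableU.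

Section MarkovChain.
Context {R : realType} {S : choiceType}.
Implicit Types Q : S -> S -> \bar R.

(* [esum] is the sum of a family of nonnegative terms; transition
   probabilities are nonnegative. *)
Fixpoint nstep Q (n : nat) (x y : S) : \bar R :=
  if n is m.+1 then (\esum_(z in [set: S]) (Q x z * nstep Q m z y)%E)
  else ((x == y)%:R)%:E.

Definition irreducible_chain Q :=
  forall x y, exists n, (0 < nstep Q n x y)%E.

(* The gcd of the possible return times n >= 1 to x is 1, for every x. *)
Definition aperiodic_chain Q :=
  forall x (d : nat),
    (forall n, (0 < n)%N -> (0 < nstep Q n x x)%E -> (d %| n)%N) -> d = 1%N.

End MarkovChain.

Section Sequences.
Context {R : realType}.

Definition walk_kernel (p : probability int R) (x y : int) : \bar R :=
  p [set y - x].

Definition irreducible_law (p : probability int R) :=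
  irreducible_chain (walk_kernel p).

Definition aperiodic_law (p : probability int R) :=
  aperiodic_chain (walk_kernel p).

Definition irreducible_aperiodic_seq (a : int -> R) :=
  exists2 p : probability int R, irreducible_law p /\ aperiodic_law p &
  exists b : int -> R,
    forall i, 0 < b i /\ ((a i)%:E = (b i)%:E * p [set i])%E.

Definition exp_moment (p : probability int R) (t : R) : \bar R :=
  \esum_(k in [set: int]) (p [set k] * (expR (t * k%:~R)%R)%:E)%E.

Definition law_class (a : int -> R) (delta c : R) : set (probability int R) :=
  [set p | (ereal_sup (exp_moment p @` [set t : R | (`|t| <= delta)%R])
              <= c%:E)%E
           /\ forall i, ((a i)%:E <= p [set i])%E].

End Sequences.

Section RandomVariables.
Context {R : realType} {d : measure_display} {T : measurableType d}.
Variable P : probability T R.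

Definition mutually_independent {d' : measure_display}
    {T' : measurableType d'} {I : finType} (X : I -> {RV P >-> T'}) :=
  forall (J : {set I}) (B : I -> set T'), (forall i, measurable (B i)) ->
    P (\bigcap_(i in [set i | i \in J]) (X i @^-1` B i)) =
    (\prod_(i in J) P (X i @^-1` B i))%E.

Definition centered (X : {RV P >-> int}) (w : T) : R :=
  (X w)%:~R - fine 'E_P[fun w' => (X w')%:~R].

(* The steps X_1, ..., X_n are indexed by 'I_n, that is by 0, ..., n - 1. *)
Definition centered_walk {n : nat} (X : 'I_n -> {RV P >-> int}) (u : R)
    (k : nat) (w : T) : R :=
  u + \sum_(i < n | (i < k)%N) centered (X i) w.

(* Minimum and maximum of s 1, ..., s n; only meaningful for n >= 1. *)
Definition min1n (s : nat -> R) (n : nat) : R :=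
  \big[Num.min/s 1%N]_(1 <= k < n.+1) s k.

Definition max1n (s : nat -> R) (n : nat) : R :=
  \big[Num.max/s 1%N]_(1 <= k < n.+1) s k.

End RandomVariables.

(* Main.v *)
Require Import Defs.
From HB Require Import structures.
From mathcomp Require Import all_boot all_order all_algebra.
From mathcomp Require Import all_classical all_reals all_analysis.
From mathcomp Require Import ring lra zify.
Set Implicit Arguments.
Unset Strict Implicit.
Unset Printing Implicit Defensive.
Import Order.TTheory GRing.Theory Num.Theory.
Import numFieldNormedType.Exports.
Local Open Scope classical_set_scope.
Local Open Scope ring_scope.


(** Cut the walk into three blocks of about n/3 steps.  On the event, the walk
    of the first block, started at u, stays in [0, lambda]; so does the walk
    which starts at v and runs backwards through the last block; and the sum of
    the middle block is determined by the other two blocks.  The blocks are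
    independent, so the probability is at most the product of two survival
    probabilities and of the largest atom of the sum of the middle block.

    Survival.  The function
      h(x) = lambda (x + A - exp(- theta x)) - x^2 / 2
    loses at least a constant c1 > 0 in mean at every step of the walk killed
    outside [0, lambda] ([lyap_drift]).  Let f_m(x) be the probability to
    survive m steps from x.  Since f_(m+1) <= 1, the drift gives by induction
      (m + 1) f_(m+1)(x) <= E[m f_m(x + Y); alive] + 1 <= h(x) / c1,
    that is f_m(x) <= h(x) / (c1 m), of order lambda (x + 1) / m
    ([survival_mul_size]).  As h is at most (1 + A) lambda^2 on [0, lambda],
    the drift also contracts h by a factor 1 - c / lambda^2 at every step
    ([survival_decay]).  Using half of a block for each estimate, and
    m >= lambda^2 / 4, this gives C (x + 1) / lambda exp(- c m / lambda^2); the
    reflection x |-> lambda - x turns x into min(x, lambda - x)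
    ([survival_uniform]).

    Concentration.  The irreducibility of the sequence a yields two integers
    i0 <> j0 with a_(i0), a_(j0) > 0.  Every step is then, with a fixed
    positive probability, a fair choice between i0 and j0, so the middle sum
    contains a number of fair choices of order n; an atom of a sum of k fair
    choices is at most the central binomial probability, of order 1 / sqrt k
    ([sum_concentration]).  This is a factor C / sqrt n <= C / lambda.

    Probabilities of events about independent integer variables are
    transported to iterated expectations of functions of lists, in an
    arbitrary order of the variables ([prob_values]); the order first block,
    reversed last block, middle block makes the three factors appear one after
    the other ([iter_expect_three_blocks]). *)

(** * Integrals against probability measures on the integers *)

Section IntegerExpectation.
Context {R : realType}.
Implicit Types (p : probability int R) (f g : int -> R).

Lemma le_integrable_int p f g : (forall z, `|f z| <= g z) ->
  p.-integrable setT (EFin \o g) -> p.-integrable setT (EFin \o f).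
Proof.
move=> fg; apply: le_integrable => //.
by move=> z _; rewrite /= lee_fin (le_trans (fg z)) ?ler_norm.
Qed.

Lemma integrable_int_cst p (r : R) : p.-integrable setT (EFin \o cst r).
Proof. by apply: finite_measure_integrable_cst. Qed.

Lemma integrable_int_bounded p f (M : R) : (forall z, `|f z| <= M) ->
  p.-integrable setT (EFin \o f).
Proof. by move=> fM; apply: le_integrable_int (integrable_int_cst p M) => z; exact: fM. Qed.

Lemma integrable_intD p f g : p.-integrable setT (EFin \o f) ->
  p.-integrable setT (EFin \o g) ->
  p.-integrable setT (EFin \o (fun z => f z + g z)).
Proof.
by move=> fi gi; have := integrableD measurableT fi gi; apply: eq_integrable.
Qed.

Lemma integrable_intZ p (r : R) f : p.-integrable setT (EFin \o f) ->
  p.-integrable setT (EFin \o (fun z => r * f z)).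
Proof.
by move=> fi; have := integrableZl measurableT r fi; apply: eq_integrable.
Qed.

Lemma Rintegral_int_cst p (r : R) : \int[p]_z r = r.
Proof. by rewrite Rintegral_cst// [X in fine X](@probability_setT _ _ _ p) mulr1. Qed.

Lemma Rintegral_int_atom p (z0 : int) (r : R) :
  \int[p]_z (r * (z == z0)%:R) = r * fine (p [set z0]).
Proof.
rewrite RintegralZl//; last first.
  apply: (@integrable_int_bounded _ _ 1) => z.
  by case: (z == z0); rewrite ?normr1 ?normr0.
congr (_ * _); rewrite /Rintegral.
rewrite (_ : (fun z => _) = EFin \o \1_([set z0] : set int)).
  by rewrite integral_indic// setIT.
apply/funext => z /=; rewrite indicE; congr (_%:R%:E).
by case: eqP => [->|zz]; [rewrite mem_set|rewrite memNset].
Qed.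

Lemma Rintegral_int_ge0 p f : (forall z, 0 <= f z) -> 0 <= \int[p]_z f z.
Proof. by move=> f0; apply: Rintegral_ge0 => z _. Qed.

Lemma Rintegral_int_le p f g : (forall z, f z <= g z) ->
  p.-integrable setT (EFin \o f) -> p.-integrable setT (EFin \o g) ->
  \int[p]_z f z <= \int[p]_z g z.
Proof. by move=> fg fi gi; apply: le_Rintegral => // z _. Qed.

Lemma Rintegral_int_le_cst p f (M : R) : (forall z, 0 <= f z <= M) ->
  0 <= \int[p]_z f z <= M.
Proof.
move=> fM; rewrite Rintegral_int_ge0 /=; last by move=> z; case/andP: (fM z).
rewrite -[leRHS](Rintegral_int_cst p); apply: Rintegral_int_le.
- by move=> z; case/andP: (fM z).
- apply: (@integrable_int_bounded _ _ M) => z; case/andP: (fM z) => *.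
  by rewrite ger0_norm.
- exact: integrable_int_cst.
Qed.

(** A partition indexed by nat, with cells that are empty or singletons: the
    countable additivity of measures and of integrals is stated over nat. *)
Definition int_cell (k : nat) : set int := [set z | pickle z = k].

Lemma int_cell_trivIset : trivIset setT int_cell.
Proof. by apply/trivIsetP => a b _ _ ab; rewrite -subset0 => z [/= h1 h2]; move: ab; rewrite -h1 -h2 eqxx. Qed.

Lemma int_cell_cover : \bigcup_k int_cell k = setT.
Proof. by rewrite -subTset => z _; exists (pickle z). Qed.

Lemma int_cellP k : int_cell k = set0 \/ exists z, int_cell k = [set z].
Proof.
have [->|/set0P[z zk]] := eqVneq (int_cell k) set0; [by left|right; exists z].
rewrite eqEsubset; split => [y yk|y ->//].
by apply: (pcan_inj (@pickleK int)); rewrite yk zk.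
Qed.

Lemma ge0_integral_int_cells (p : probability int R) (f : int -> R) :
  (forall z, 0 <= f z) ->
  (\int[p]_z (f z)%:E = \sum_(k <oo) \int[p]_(z in int_cell k) (f z)%:E)%E.
Proof.
move=> f0; rewrite -{1}int_cell_cover ge0_integral_bigcup//.
- by move=> z _; rewrite lee_fin.
- exact: int_cell_trivIset.
Qed.

Lemma integral_int_set1 p (f : int -> R) z :
  (\int[p]_(y in [set z]) (f y)%:E = (f z)%:E * p [set z])%E.
Proof.
rewrite (eq_integral (cst (f z)%:E)) ?integral_cst//=.
by move=> y; rewrite inE => ->.
Qed.

(** Exponential moments are given as sums, expectations as integrals. *)
Lemma ge0_integral_int_esum p (f : int -> R) : (forall z, 0 <= f z) ->
  (\int[p]_z (f z)%:E = \esum_(z in [set: int]) (p [set z] * (f z)%:E))%E.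
Proof.
move=> f0.
have a0 z : (0 <= p [set z] * (f z)%:E)%E by rewrite mule_ge0// lee_fin.
rewrite ge0_integral_int_cells// nneseries_esumT; last first.
  by move=> k; apply: integral_ge0 => z _; rewrite lee_fin.
rewrite -int_cell_cover esum_bigcupT//; last exact: int_cell_trivIset.
apply: eq_esum => k _; have [->|[z ->]] := int_cellP k.
  by rewrite integral_set0 esum_set0.
by rewrite integral_int_set1 esum_set1// muleC.
Qed.

End IntegerExpectation.

(** * A Lyapunov function for a walk killed outside an interval *)

Section RealInequalities.
Context {R : realType}.
Implicit Types s t x y : R.

(** Cube of 1 + t <= exp t at t = s / 3 when s >= -3; otherwise the left-hand
    side is negative.  This is a lower bound 1 + s + s^2/3 + s^3/27 valid for
    all s, which makes - exp(- theta x) strictly superharmonic for a centered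
    step with a third moment. *)
Lemma expR_ge_cube s : (1 + s / 3) ^+ 3 <= expR s.
Proof.
have -> : expR s = expR (s / 3) ^+ 3.
  by rewrite -expRM_natl; congr expR; field.
have h1 := expR_ge1Dx (s / 3); have h2 := expR_gt0 (s / 3).
move: h1 h2; move: (expR _) => e; move: (s / 3) => a h1 h2.
have [h|h] := leP 0 (1 + a); first by rewrite lerXn2r// nnegrE ltW.
apply: (@le_trans _ _ 0); last by rewrite exprn_ge0 ?ltW.
by rewrite exprS nmulr_rle0// sqr_ge0.
Qed.

Lemma expR_le s t : s <= t -> expR s <= expR t.
Proof. by rewrite ler_expR. Qed.

Lemma le_expR_div (th t : R) : 0 < th -> t <= expR (th * t) / th.
Proof.
move=> th0; rewrite ler_pdivlMr// mulrC.
by apply: le_trans (expR_ge1Dx _); lra.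
Qed.

Lemma le_sqr_expR (th t : R) : 0 < th -> 0 <= t ->
  t ^+ 2 <= 2 / th ^+ 2 * expR (th * t).
Proof.
move=> th0 t0.
have h := @expR_ge1Dxn R (th * t) 1 (mulr_ge0 (ltW th0) t0).
have -> : t ^+ 2 = 2 / th ^+ 2 * ((th * t) ^+ 2 / 2) by field; rewrite gt_eqF.
rewrite ler_pM2l ?divr_gt0 ?exprn_gt0//.
by apply: le_trans h; rewrite !factS fact0 mul1n muln1 lerDr.
Qed.

Lemma le_cube_expR (th t : R) : 0 < th -> 0 <= t ->
  t ^+ 3 <= 6 / th ^+ 3 * expR (th * t).
Proof.
move=> th0 t0.
have h := @expR_ge1Dxn R (th * t) 2 (mulr_ge0 (ltW th0) t0).
have -> : t ^+ 3 = 6 / th ^+ 3 * ((th * t) ^+ 3 / 6) by field; rewrite gt_eqF.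
rewrite ler_pM2l ?divr_gt0 ?exprn_gt0//.
by apply: le_trans h; rewrite (_ : 3`! = 6)%N// lerDr.
Qed.

(** The quadratic term decreases in mean by half the variance of a step, and the
    linear term keeps the function positive on [0, lam] and of order
    lam * (x + 1).  Killing below 0 loses the negative values taken by the
    function at large undershoots; these cost O(lam exp(- th x)), which the
    strictly superharmonic term - lam * exp(- th x) pays for. *)
Definition lyap (th A lam x : R) : R :=
  lam * (x + A - expR (- (th * x))) - x ^+ 2 / 2.

(** A constant such that t + exp(th t) + t^2 / (2 lam) <= lyapB th * exp(th t)
    for t >= 0 and lam >= 1. *)
Definition lyapB (th : R) : R := 1 / th + 1 + 1 / th ^+ 2.

(** With t the undershoot, the loss is at most lam * (B exp(th t) - A), and
    w - A <= w^2 / (4 A) for every w: a large A makes the loss small, while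
    exp(2 th t) <= exp(- th x) exp(2 th |y|) keeps the decay in x. *)
Lemma lyap_below (th A lam x y : R) : 0 < th -> 0 < A -> 1 <= lam ->
  0 <= x -> x + y < 0 ->
  - lyap th A lam (x + y) <=
    lam * expR (- (th * x)) * (lyapB th ^+ 2 / (4 * A)) * expR (2 * th * `|y|).
Proof.
move=> th0 A0 lam1 x0 xy0.
have lam0 : 0 < lam by lra.
have [t tE] : exists t, t = - (x + y) by exists (- (x + y)).
have t0 : 0 < t by lra.
have -> : x + y = - t by lra.
have ny : `|y| = x + t by rewrite ltr0_norm; lra.
have E0 := expR_gt0 (th * t).
have E1 : expR (2 * th * `|y|) * expR (- (th * x)) >= expR (th * t) ^+ 2.
  rewrite -expRM_natl -expRD ny; apply: expR_le.
  have : 0 <= th * x by apply: mulr_ge0 => //; apply: ltW.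
  lra.
set B := lyapB th.
have B1 : t + expR (th * t) + t ^+ 2 / 2 / lam <= B * expR (th * t).
  have h1 := le_expR_div t th0.
  have h2 := le_sqr_expR th0 (ltW t0).
  have h3 : t ^+ 2 / 2 / lam <= t ^+ 2 / 2.
    by rewrite ler_pdivrMr// ler_peMr// divr_ge0 ?sqr_ge0.
  have h4 : t ^+ 2 / 2 <= 1 / th ^+ 2 * expR (th * t).
    lra.
  rewrite /B /lyapB; lra.
have B2 : B * expR (th * t) - A <= B ^+ 2 / (4 * A) * expR (th * t) ^+ 2.
  rewrite -subr_ge0.
  have -> : B ^+ 2 / (4 * A) * expR (th * t) ^+ 2 - (B * expR (th * t) - A)
    = (B * expR (th * t) - 2 * A) ^+ 2 / (4 * A) by field; rewrite gt_eqF.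
  by rewrite divr_ge0 ?sqr_ge0//; lra.
have -> : - lyap th A lam (- t) =
   lam * (t + expR (th * t) + t ^+ 2 / 2 / lam - A).
  by rewrite /lyap !mulrN opprK; field; rewrite gt_eqF.
rewrite -!mulrA ler_pM2l//.
apply: (@le_trans _ _ (B ^+ 2 / (4 * A) * expR (th * t) ^+ 2)); first by lra.
rewrite [X in _ <= X](_ : _ = B ^+ 2 / (4 * A) * (expR (2 * th * `|y|) * expR (- (th * x)))); last first.
  by rewrite -!mulrA; ring.
rewrite ler_wpM2l// divr_ge0 ?sqr_ge0//; lra.
Qed.

(** The function is nonnegative up to 2 lam, so that a loss needs an overshoot
    by a step y >= lam, and then it is of order y^2 <= |y|^3 / lam. *)
Lemma lyap_above (th A lam x y : R) : 0 < th -> 1 <= A -> 1 <= lam ->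
  x <= lam -> lam < x + y ->
  - lyap th A lam (x + y) <= 2 * `|y| ^+ 3 / lam.
Proof.
move=> th0 A0 lam1 xl xy.
have lam0 : 0 < lam by lra.
have y0 : 0 < y by lra.
rewrite gtr0_norm//.
have E1 : expR (- (th * (x + y))) <= 1.
  by rewrite expR_le1 oppr_le0 mulr_ge0//; lra.
set w := x + y in xy E1 *.
have h1 : - lyap th A lam w <= w * (w / 2 - lam).
  rewrite /lyap.
  have : 0 <= lam * (A - expR (- (th * w))) by apply: mulr_ge0; lra.
  lra.
apply: (le_trans h1).
have [h|h] := leP w (2 * lam).
  apply: (@le_trans _ _ 0); last by rewrite divr_ge0 ?mulr_ge0 ?exprn_ge0//; lra.
  apply: mulr_ge0_le0; lra.
have yl : lam <= y by rewrite /w in h; lra.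
have wy : w <= 2 * y by rewrite /w; lra.
rewrite ler_pdivlMr//.
apply: (@le_trans _ _ (2 * y ^+ 2 * lam)); last first.
  have -> : 2 * y ^+ 3 = 2 * y ^+ 2 * y by ring.
  by rewrite ler_wpM2l// mulr_ge0// sqr_ge0.
rewrite ler_wpM2r//; first lra.
have : 0 <= w * lam by apply: mulr_ge0; lra.
have : w ^+ 2 <= (2 * y) ^+ 2 by rewrite lerXn2r ?nnegrE; lra.
nra.
Qed.

Definition band lam x : bool := 0 <= x <= lam.

(** Taylor-like bound in the step y with only the four integrands 1, y, y^2 and
    exp(del |y|), whose expectations are controlled for a centered step. *)
Lemma lyap_step (th A lam del x y : R) :
  0 < th -> 2 * th <= del -> 2 <= A -> 1 <= lam -> 0 <= x <= lam ->
  (band lam (x + y))%:R * lyap th A lam (x + y) <=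
  lyap th A lam x + (lam - x + lam * th * expR (- (th * x))) * y
  - (1 / 2 + lam * expR (- (th * x)) * (th ^+ 2 / 3)) * y ^+ 2
  + (12 / (lam * del ^+ 3) + lam * expR (- (th * x)) *
      (th ^+ 3 * (6 / 27) / del ^+ 3 + lyapB th ^+ 2 / (4 * A)))
    * expR (del * `|y|).
Proof.
move=> th0 thd A2 lam1 /andP[x0 xl].
have lam0 : 0 < lam by lra.
have del0 : 0 < del by lra.
have [n nE] : exists n : R, n = `|y| by exists `|y|.
have n0 : 0 <= n by rewrite nE.
rewrite -nE.
set e := expR (- (th * x)); have e0 : 0 < e by apply: expR_gt0.
set G := expR (del * n); have G0 : 0 < G by apply: expR_gt0.
set U := lam * e; have U0 : 0 < U by apply: mulr_gt0.
have hy3 := le_cube_expR del0 n0.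
rewrite -/G in hy3.
(* Without killing: all terms are exact but exp(- th y). *)
have h1 : lyap th A lam (x + y) <= lyap th A lam x + (lam - x + U * th) * y
  - (1 / 2 + U * (th ^+ 2 / 3)) * y ^+ 2 + U * (th ^+ 3 / 27) * n ^+ 3.
  have -> : lyap th A lam (x + y) = lyap th A lam x + lam * y - x * y - y ^+ 2 / 2
     - U * (expR (- (th * y)) - 1).
    rewrite /lyap (_ : - (th * (x + y)) = - (th * x) + - (th * y)); last by ring.
    by rewrite expRD -/e /U; field.
  have h2 := expR_ge_cube (- (th * y)).
  have h3 : - (th * y) ^+ 3 / 27 >= - (th ^+ 3 / 27 * n ^+ 3).
    have h4 : y ^+ 3 <= n ^+ 3 by rewrite nE -normrX ler_norm.
    have h5 : 0 <= th ^+ 3 / 27 by rewrite divr_ge0 ?exprn_ge0// ltW.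
    have := ler_wpM2l h5 h4; rewrite exprMn; lra.
  have h6 : expR (- (th * y)) - 1 >= - (th * y) + th ^+ 2 / 3 * y ^+ 2 - th ^+ 3 / 27 * n ^+ 3.
    apply: le_trans (_ : - (th * y) + (th * y) ^+ 2 / 3 - (th * y) ^+ 3 / 27 <= _); last by lra.
    by rewrite !exprMn; lra.
  have := ler_wpM2l (ltW U0) h6; lra.
have lossU0 : U * (lyapB th ^+ 2 / (4 * A)) >= 0.
  apply: mulr_ge0; first exact: ltW.
  by apply: divr_ge0; [exact: sqr_ge0 | lra].
have lossU : U * (lyapB th ^+ 2 / (4 * A)) * G >= 0.
  by apply: mulr_ge0 => //; exact: ltW.
have y3 : 0 <= n ^+ 3 by rewrite exprn_ge0.
have hB : 2 * n ^+ 3 / lam <= 12 / (lam * del ^+ 3) * G.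
  rewrite ler_pdivrMr// [X in _ <= X](_ : _ = 2 * (6 / del ^+ 3 * G)); last first.
    by field; rewrite !gt_eqF.
  by rewrite ler_pM2l.
have hC : U * (th ^+ 3 / 27) * n ^+ 3 <= U * (th ^+ 3 * (6 / 27) / del ^+ 3) * G.
  rewrite [X in _ <= X](_ : _ = U * (th ^+ 3 / 27) * (6 / del ^+ 3 * G)); last first.
    by field; rewrite !gt_eqF.
  apply: ler_wpM2l => //; apply: mulr_ge0; first exact: ltW.
  by apply: divr_ge0 => //; apply: exprn_ge0; exact: ltW.
have lossB : 0 <= 2 * n ^+ 3 / lam.
  by apply: divr_ge0; [exact: mulr_ge0 | lra].
(* Killing adds the negative part of the function outside [0, lam]. *)
have h7 : (band lam (x + y))%:R * lyap th A lam (x + y) <= lyap th A lam (x + y)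
   + U * (lyapB th ^+ 2 / (4 * A)) * G + 2 * n ^+ 3 / lam.
  have [h|/negP h] := boolP (band lam (x + y)); first by rewrite mul1r; lra.
  rewrite mul0r.
  have [h8|h8] := ltP (x + y) 0.
    have A0 : 0 < A by lra.
    have h9 := lyap_below th0 A0 lam1 x0 h8; rewrite -nE in h9.
    have h10 : U * (lyapB th ^+ 2 / (4 * A)) * expR (2 * th * n) <=
      U * (lyapB th ^+ 2 / (4 * A)) * G.
      by rewrite ler_wpM2l//; apply: expR_le; rewrite ler_wpM2r.
    rewrite -/e -/U in h9; lra.
  have h9 : lam < x + y by rewrite ltNge; apply/negP => h10; apply: h; rewrite /band h8.
  have A1 : 1 <= A by lra.
  have := lyap_above th0 A1 lam1 xl h9; rewrite -nE; lra.
have UE : lam * th * e = U * th by rewrite /U; ring.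
rewrite UE; move: h7 h1 hB hC; clear.
move: (12 / (lam * del ^+ 3)) (lyapB th ^+ 2 / (4 * A)) (th ^+ 3 * (6 / 27) / del ^+ 3) => a1 a2 a3.
clearbody U G; lra.
Qed.

End RealInequalities.

Section Lyapunov.
Context {R : realType}.
Implicit Types (p : probability int R) (g : int -> R).

(** A centered step, of variance at least s2 and with an exponential moment:
    stable under y |-> - y, hence under time reversal of the walk and under
    reflection of the interval. *)
Definition good_step (del s2 K : R) p g :=
  [/\ p.-integrable setT (EFin \o (fun z => expR (del * `|g z|))),
      \int[p]_z expR (del * `|g z|) <= K,
      \int[p]_z g z = 0 & s2 <= \int[p]_z (g z ^+ 2)].

Lemma good_step_integrable del s2 K p g : 0 < del ->
  good_step del s2 K p g ->
  p.-integrable setT (EFin \o g) /\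
  p.-integrable setT (EFin \o (fun z => g z ^+ 2)).
Proof.
move=> d0 [h1 _ _ _]; split.
  apply: (le_integrable_int (g := fun z => del^-1 * expR (del * `|g z|))).
    by move=> z; rewrite mulrC; exact: le_expR_div.
  exact: integrable_intZ.
apply: (le_integrable_int (g := fun z => 2 / del ^+ 2 * expR (del * `|g z|))).
  by move=> z; rewrite normrX; exact: le_sqr_expR.
exact: integrable_intZ.
Qed.

Lemma good_stepN del s2 K p g : 0 < del ->
  good_step del s2 K p g -> good_step del s2 K p (fun z => - g z).
Proof.
move=> d0 H; have [gi _] := good_step_integrable d0 H.
have e1 : (fun z : int => expR (del * `|- g z|)) = (fun z => expR (del * `|g z|)).
  by apply/funext => z; rewrite normrN.
have e2 : (fun z : int => (- g z) ^+ 2) = (fun z => g z ^+ 2).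
  by apply/funext => z; rewrite sqrrN.
have e3 : (fun z : int => - g z) = (fun z => -1 * g z).
  by apply/funext => z; rewrite mulN1r.
case: H => h1 h2 h3 h4; rewrite /good_step e1 e2; split => //.
by rewrite e3 RintegralZl ?h3 ?mulr0.
Qed.

Lemma lyap_bounds (th A lam x : R) : 0 < th -> 2 <= A -> 1 <= lam ->
  band lam x -> 0 <= lyap th A lam x <= lam * (x + A).
Proof.
move=> th0 A2 lam1 /andP[x0 xl].
have E1 : expR (- (th * x)) <= 1.
  by rewrite expR_le1 oppr_le0 mulr_ge0//; lra.
have E0 := expR_gt0 (- (th * x)); move: E0 E1; rewrite /lyap.
move: (expR _) => e e0 e1.
have h1 : 0 <= lam * e by apply: mulr_ge0; lra.
have h2 : lam * (x + 1) <= lam * (x + A - e) by apply: ler_wpM2l; lra.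
have h3 : x ^+ 2 <= lam * x by rewrite expr2 ler_wpM2r.
have h4 := sqr_ge0 x.
apply/andP; split; last lra.
have : 0 <= lam * x by apply: mulr_ge0; lra.
lra.
Qed.

Lemma lyap_le_max (th A lam x : R) : 0 < th -> 2 <= A -> 1 <= lam ->
  band lam x -> lyap th A lam x <= (1 + A) * lam ^+ 2.
Proof.
move=> th0 A2 lam1 xb; have /andP[_ h] := lyap_bounds th0 A2 lam1 xb.
apply: (le_trans h); rewrite expr2 mulrCA; apply: ler_wpM2l; first lra.
have /andP[_ xl] := xb.
have : 0 <= (A - 1) * (lam - 1) by apply: mulr_ge0; lra.
nra.
Qed.

(** The first condition on the constants lets the gain of the exponential term
    absorb the undershoot, the second lets s2 / 4 absorb the overshoot; the
    quadratic term has a gain of s2 / 2. *)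
Lemma lyap_drift (th A lam del s2 K : R) p g x :
  0 < th -> 2 * th <= del -> 2 <= A -> 1 <= lam -> band lam x ->
  K * (th ^+ 3 * (6 / 27) / del ^+ 3 + lyapB th ^+ 2 / (4 * A)) <= th ^+ 2 / 3 * s2 ->
  12 / (lam * del ^+ 3) * K <= s2 / 4 ->
  good_step del s2 K p g ->
  \int[p]_z ((band lam (x + g z))%:R * lyap th A lam (x + g z)) <=
    lyap th A lam x - s2 / 4.
Proof.
move=> th0 thd A2 lam1 xb c1 c2 gs.
have d0 : 0 < del by lra.
have [gi g2i] := good_step_integrable d0 gs.
have [h1 h2 h3 h4] := gs.
have lam0 : 0 < lam by lra.
set al := lam - x + lam * th * expR (- (th * x)).
set be := 1 / 2 + lam * expR (- (th * x)) * (th ^+ 2 / 3).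
set ga := 12 / (lam * del ^+ 3) + lam * expR (- (th * x)) *
      (th ^+ 3 * (6 / 27) / del ^+ 3 + lyapB th ^+ 2 / (4 * A)).
have U0 : 0 < lam * expR (- (th * x)) by rewrite mulr_gt0// expR_gt0.
have be0 : 0 <= be.
  by apply: addr_ge0 => //; apply: mulr_ge0; [exact: ltW|rewrite divr_ge0// sqr_ge0].
have ga0 : 0 <= ga.
  apply: addr_ge0; first by rewrite divr_ge0// mulr_ge0 ?exprn_ge0// ltW.
  apply: mulr_ge0; first exact: ltW.
  apply: addr_ge0; last by apply: divr_ge0; [exact: sqr_ge0|lra].
  by apply: divr_ge0; [apply: mulr_ge0; [apply: exprn_ge0; exact: ltW|]|apply: exprn_ge0; exact: ltW].
pose r z := lyap th A lam x + (al * g z + (- be * g z ^+ 2 + ga * expR (del * `|g z|))).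
have i1 := integrable_intZ al gi.
have i2 := integrable_intZ (- be) g2i.
have i3 := integrable_intZ ga h1.
have i23 := integrable_intD i2 i3.
have i123 := integrable_intD i1 i23.
have i0 := integrable_int_cst p (lyap th A lam x).
apply: (@le_trans _ _ (\int[p]_z r z)).
  apply: Rintegral_int_le.
  - move=> z; have := lyap_step (g z) th0 thd A2 lam1 xb.
    by rewrite -/al -/be -/ga /r; lra.
  - apply: (@integrable_int_bounded _ _ _ ((1 + A) * lam ^+ 2)) => z.
    have [b|b] := boolP (band lam (x + g z)); last first.
      by rewrite mul0r normr0 mulr_ge0 ?sqr_ge0//; lra.
    have /andP[? _] := lyap_bounds th0 A2 lam1 b.
    by rewrite mul1r ger0_norm// lyap_le_max.
  - exact: integrable_intD i0 i123.
rewrite /r (RintegralD _ i0 i123)// (RintegralD _ i1 i23)// (RintegralD _ i2 i3)//.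
rewrite Rintegral_int_cst !RintegralZl// h3 mulr0 add0r.
have h5 : be * s2 <= be * \int[p]_z (g z ^+ 2) by rewrite ler_wpM2l.
have h6 : ga * \int[p]_z expR (del * `|g z|) <= ga * K by rewrite ler_wpM2l.
have h7 : ga * K <= s2 / 4 + lam * expR (- (th * x)) * (th ^+ 2 / 3 * s2).
  rewrite /ga mulrDl; apply: lerD => //.
  by rewrite -[X in X <= _]mulrA [_ * K]mulrC; apply: ler_wpM2l; first exact: ltW.
have h8 : be * s2 = s2 / 2 + lam * expR (- (th * x)) * (th ^+ 2 / 3 * s2).
  by rewrite /be; ring.
move: h5 h6 h7 h8.
move: (\int[p]_z (g z ^+ 2)) (\int[p]_z expR _) (lyap th A lam x) => a1 a2 a3.
move: (lam * expR (- (th * x)) * (th ^+ 2 / 3 * s2)) => a4.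
clear; clearbody be ga; lra.
Qed.

End Lyapunov.

(** * Iterated expectations and survival probabilities *)

Section IteratedExpectation.
Context {R : realType} {I : Type} (p : I -> probability int R).
Implicit Types (F G : seq int -> R) (ii : seq I).

(** Expectation of F (z_1, ..., z_k) for independent z_j of law p i_j. *)
Fixpoint iter_expect ii F : R :=
  if ii is i :: ii' then \int[p i]_z iter_expect ii' (fun s => F (z :: s)) else F [::].

Lemma iter_expect_bound ii F (M : R) : (forall s, 0 <= F s <= M) -> 0 <= iter_expect ii F <= M.
Proof.
elim: ii F => [|i ii IH] F FM /=; first exact: FM.
by apply: Rintegral_int_le_cst => z; apply: IH => s.
Qed.

Lemma iter_expect_integrable i ii F (M : R) : (forall s, 0 <= F s <= M) ->
  (p i).-integrable setT (EFin \o (fun z => iter_expect ii (fun s => F (z :: s)))).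
Proof.
move=> FM; apply: (@integrable_int_bounded _ _ _ M) => z.
have /andP[h1 h2] : 0 <= iter_expect ii (fun s => F (z :: s)) <= M by apply: iter_expect_bound.
by rewrite ger0_norm.
Qed.

Lemma iter_expect_le ii F G (M : R) : (forall s, 0 <= F s <= M) ->
  (forall s, 0 <= G s <= M) -> (forall s, size s = size ii -> F s <= G s) ->
  iter_expect ii F <= iter_expect ii G.
Proof.
elim: ii F G => [|i ii IH] F G FM GM FG /=; first exact: FG.
apply: Rintegral_int_le; try exact: (@iter_expect_integrable _ _ _ M).
by move=> z; apply: IH => // s ss; apply: FG; rewrite /= ss.
Qed.

Lemma iter_expectZ ii F (r M : R) : (forall s, 0 <= F s <= M) ->
  iter_expect ii (fun s => r * F s) = r * iter_expect ii F.
Proof.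
elim: ii F => [//|i ii IH] F FM /=.
rewrite -RintegralZl//; last exact: (@iter_expect_integrable _ _ _ M).
by apply: eq_Rintegral => z _; rewrite IH.
Qed.

Lemma iter_expect_cat ii1 ii2 F :
  iter_expect (ii1 ++ ii2) F = iter_expect ii1 (fun s1 => iter_expect ii2 (fun s2 => F (s1 ++ s2))).
Proof.
elim: ii1 F => [//|i ii1 IH] F /=.
by apply: eq_Rintegral => z _; rewrite IH.
Qed.

End IteratedExpectation.

Section Survival.
Context {R : realType} {I : Type} (p : I -> probability int R) (lam : R).
Implicit Types (g : I -> int -> R) (ii : seq I) (x : R).

(** The starting point x itself is not constrained. *)
Fixpoint stay g x ii (s : seq int) : bool :=
  match ii, s with
  | i :: ii', z :: s' => band lam (x + g i z) && stay g (x + g i z) ii' s'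
  | _, _ => true
  end.

Definition survival g x ii : R := iter_expect p ii (fun s => (stay g x ii s)%:R).

Lemma natr_bool_bound (b : bool) : 0 <= (b%:R : R) <= 1.
Proof. by case: b; rewrite ?lexx ler01. Qed.

Lemma survival_bound g x ii : 0 <= survival g x ii <= 1.
Proof. by apply: iter_expect_bound => s; exact: natr_bool_bound. Qed.

Lemma survival_cons g x i ii : survival g x (i :: ii) =
  \int[p i]_z ((band lam (x + g i z))%:R * survival g (x + g i z) ii).
Proof.
rewrite /survival /=; apply: eq_Rintegral => z _.
rewrite -(@iter_expectZ _ _ _ _ _ _ 1); last by move=> s; exact: natr_bool_bound.
by congr iter_expect; apply/funext => s; rewrite -natrM mulnb.
Qed.

Lemma band_reflect x : band lam (lam - x) = band lam x.
Proof. by rewrite /band; apply/idP/idP => /andP[? ?]; apply/andP; split; lra. Qed.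

Lemma survival_reflect g x ii :
  survival (fun i z => - g i z) (lam - x) ii = survival g x ii.
Proof.
rewrite /survival; congr iter_expect; apply/funext => s; congr (_%:R); congr nat_of_bool.
elim: ii x s => [//|i ii IH] x [//|z s] /=.
have -> : lam - x - g i z = lam - (x + g i z) by ring.
by rewrite band_reflect IH.
Qed.

Context (g : I -> int -> R) (h : R -> R) (c1 Hm : R).
Context (c1_gt0 : 0 < c1) (Hm_gt0 : 0 < Hm).
Context (h_bound : forall x, band lam x -> 0 <= h x <= Hm).
Context (h_drift : forall i x, band lam x ->
  \int[p i]_z ((band lam (x + g i z))%:R * h (x + g i z)) <= h x - c1).

Let h_int i x (w : R) :
  (p i).-integrable setT
    (EFin \o (fun z => w * ((band lam (x + g i z))%:R * h (x + g i z)))).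
Proof.
apply: integrable_intZ; apply: (@integrable_int_bounded _ _ _ Hm) => z.
have [b|b] := boolP (band _ _); last by rewrite mul0r normr0 ltW.
by have /andP[h0 h1] := h_bound b; rewrite mul1r ger0_norm.
Qed.

Let survival_int i x ii (w : R) :
  (p i).-integrable setT
    (EFin \o (fun z => w * ((band lam (x + g i z))%:R * survival g (x + g i z) ii))).
Proof.
apply: integrable_intZ; apply: (@integrable_int_bounded _ _ _ 1) => z.
have /andP[s0 s1] := survival_bound g (x + g i z) ii.
by case: (band _ _); rewrite ?mul0r ?mul1r ?normr0// ger0_norm.
Qed.

(** The drift of h in the form used by both inductions below. *)
Lemma survival_step_le x i ii (w w' : R) : 0 <= w' ->
  (forall y, band lam y -> w * survival g y ii <= w' * h y) -> band lam x ->
  w * survival g x (i :: ii) <= w' * (h x - c1).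
Proof.
move=> w0 H xb; rewrite survival_cons -RintegralZl//; last first.
  by have := survival_int i x ii 1; congr (_.-integrable _ _); apply/funext => z; rewrite /= mul1r.
apply: (@le_trans _ _ (\int[p i]_z (w' * ((band lam (x + g i z))%:R * h (x + g i z))))).
  apply: Rintegral_int_le => // z.
  have [b|b] := boolP (band _ _); last by rewrite !mul0r !mulr0.
  by rewrite !mul1r H.
rewrite RintegralZl//; first by rewrite ler_wpM2l// h_drift.
by have := h_int i x 1; congr (_.-integrable _ _); apply/funext => z; rewrite /= mul1r.
Qed.

(** Induction on (m + 1) f_(m+1) = E[m f_m; alive] + f_(m+1): the first term is
    at most (h - c1) / c1 by the drift, and the second is at most 1. *)
Lemma survival_mul_size x ii : band lam x -> (size ii)%:R * survival g x ii <= c1^-1 * h x.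
Proof.
have ci0 : 0 <= c1^-1 by rewrite invr_ge0 ltW.
elim: ii x => [|i ii IH] x xb /=.
  by rewrite mul0r mulr_ge0//; case/andP: (h_bound xb).
rewrite -addn1 natrD mulrDl mul1r.
have h1 := survival_step_le i ci0 IH xb.
have /andP[_ h2] := survival_bound g x (i :: ii).
apply: le_trans (lerD h1 h2) _.
by rewrite mulrBr mulVf ?gt_eqF// subrK.
Qed.

(** As h <= Hm, the drift gives h - c1 <= (1 - c1 / Hm) h. *)
Lemma survival_decay x ii1 ii2 (w : R) : 0 <= w ->
  (forall y, band lam y -> survival g y ii2 <= w * h y) -> band lam x ->
  survival g x (ii1 ++ ii2) <= w * expR (- (c1 / Hm * (size ii1)%:R)) * h x.
Proof.
move=> w0 H; elim: ii1 x => [|i ii1 IH] x xb.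
  by rewrite /= mulr0 oppr0 expR0 mulr1 H.
set w' := w * _ in IH.
have w'0 : 0 <= w' by rewrite mulr_ge0// expR_ge0.
have := @survival_step_le x i (ii1 ++ ii2) 1 w' w'0.
rewrite mul1r => /(_ _ xb) h1; apply: le_trans (h1 _) _.
  by move=> y yb; rewrite mul1r; exact: IH.
have -> : w * expR (- (c1 / Hm * (size (i :: ii1))%:R)) =
    w' * expR (- (c1 / Hm)).
  by rewrite /w' -[RHS]mulrA -expRD; congr (_ * expR _); rewrite /= -addn1 natrD; ring.
rewrite -mulrA; apply: ler_wpM2l => //.
have /andP[h0 hM] := h_bound xb.
apply: (@le_trans _ _ ((1 - c1 / Hm) * h x)).
  rewrite mulrBl mul1r lerD2l lerN2 mulrAC.
  by rewrite ler_pdivrMr// ler_pM2l.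
by apply: ler_wpM2r => //; exact: expR_ge1Dx.
Qed.

(** The first k steps are used for exponential decay, the others for the
    estimate in 1 / size. *)
Lemma survival_exp_bound x ii k : band lam x -> (k < size ii)%N ->
  survival g x ii <=
  expR (- (c1 / Hm * k%:R)) * h x / (c1 * (size ii - k)%:R).
Proof.
move=> xb km; rewrite -{1}(cat_take_drop k ii).
have m0 : 0 < (size ii - k)%:R :> R by rewrite ltr0n subn_gt0.
have := @survival_decay x (take k ii) (drop k ii) (c1 * (size ii - k)%:R)^-1.
rewrite size_take km => h1; apply: le_trans (h1 _ _ xb) _.
- by rewrite invr_ge0 mulr_ge0// ltW.
- move=> y yb; have := survival_mul_size (drop k ii) yb; rewrite size_drop => h2.
  by rewrite invfM mulrAC ler_pdivlMr// mulrC.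
- by rewrite mulrC mulrA mulrAC [h x * _]mulrC.
Qed.

End Survival.

(** * The central binomial coefficient *)

Section Binomial.

(** The binomial coefficients increase up to the middle one. *)
Lemma leq_bin_half k l : ('C(k, l) <= 'C(k, k./2))%N.
Proof.
wlog lk : l / (l <= k./2)%N.
  move=> H; have [|h] := leqP l k./2; first exact: H.
  have [h2|h2] := leqP l k; last by rewrite bin_small.
  by rewrite -bin_sub//; apply: H; lia.
have [j jE] : exists j, (k./2 = l + j)%N by exists (k./2 - l)%N; rewrite subnKC.
elim: j l lk jE => [|j IH] l lk jE; first by rewrite jE addn0.
apply: leq_trans (IH l.+1 _ _); last 2 first.
- by rewrite jE; lia.
- by rewrite jE; lia.
have h := mul_bin_left k l.
have : (l.+1 * 'C(k, l) <= l.+1 * 'C(k, l.+1))%N.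
  by rewrite h leq_mul2r; apply/orP; right; lia.
by rewrite leq_pmul2l.
Qed.

(** For even k = 2 m, by induction on m with C(2m+2, m+1) (m+1) =
    2 (2m+1) C(2m, m) and (2m+1) (2m+3) <= 4 (m+1)^2; the odd case follows from
    2 C(2m+1, m) = C(2m+2, m+1). *)
Lemma bin_half_sqr k : ('C(k, k./2) ^ 2 * k.+1 <= 4 ^ k)%N.
Proof.
have ev m : ('C(m.*2, m) ^ 2 * m.*2.+1 <= 4 ^ m.*2)%N /\
            (2 * 'C(m.*2.+1, m) = 'C(m.+1.*2, m.+1))%N.
  elim: m => [|m [IH1 IH2]]; first by [].
  have h2 := mul_bin_down m.*2.+1 m.
  have s1 : (m.*2.+1 - m = m.+1)%N by lia.
  rewrite s1 /= in h2.
  split; last first.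
    have h1 := mul_bin_diag m.+2.*2 m.+1.
    rewrite doubleS /= in h1 *.
    have : (m.+2 * (2 * 'C(m.+1.*2.+1, m.+1)) = m.+2 * 'C(m.+1.*2.+2, m.+2))%N.
      by rewrite -h1 mulnA; congr (_ * _)%N; lia.
    by move/eqP; rewrite eqn_pmul2l// => /eqP.
  rewrite -IH2.
  rewrite doubleS !expnS.
  move: IH1 h2; move: ('C(_, _)) => c0; move: ('C(_, _)) => c1.
  move: (4 ^ m.*2)%N => w IH1 h2.
  have h3 : (m.+1 ^ 2 * (2 * c1 * (2 * c1) * m.*2.+3) <= m.+1 ^ 2 * (16 * w))%N.
    have -> : (m.+1 ^ 2 * (2 * c1 * (2 * c1) * m.*2.+3) =
      4 * m.*2.+3 * (m.+1 * c1) ^ 2)%N by ring.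
    rewrite -h2.
    have -> : (4 * m.*2.+3 * (m.*2.+1 * c0) ^ 2 = 4 * m.*2.+3 * m.*2.+1 * (c0 ^ 2 * m.*2.+1))%N by ring.
    apply: leq_trans (_ : 4 * m.*2.+3 * m.*2.+1 * w <= _)%N; first by rewrite leq_mul2l IH1 orbT.
    by rewrite mulnA leq_mul2r; apply/orP; right; rewrite -muln2; nia.
  by move: h3; rewrite leq_pmul2l ?expn_gt0//; rewrite !expn0 ?muln1 -?mulnA (mulnA 4 4).
move: (odd_double_half k); move: (k./2) (odd k) => h b <-.
have [h1 h2] := ev h; have [h3 _] := ev h.+1.
case: b => /=; last by rewrite add0n.
rewrite add1n; move: h3; rewrite -h2 doubleS !expnS => h3.
rewrite -(@leq_pmul2l 4)//.
move: h3; rewrite !expn0; move: 'C(_, _) (4 ^ _)%N => c w; nia.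
Qed.

End Binomial.

(** * Concentration of sums of independent steps *)

(** s |-> 1 / s is convex, so averaging it over s and s + 1 with weights
    1 - 2 eps and 2 eps gives more than its value at s + 2 eps; it is still
    below the value at s + eps. *)
Lemma recip_mix_le {R : realType} (eps eta s : R) :
  0 < eps -> 0 < eta -> 1 <= s ->
  2 * eps * ((eta + 1 / (eta * (s + 1))) / 2) +
    (1 - 2 * eps) * ((eta + 1 / (eta * s)) / 2) <=
  (eta + 1 / (eta * (s + eps))) / 2.
Proof.
move=> eps0 eta0 s1.
have s0 : 0 < s by lra.
have se : 0 < s + eps by lra.
have s2 : 0 < s + 1 by lra.
rewrite -subr_ge0.
have -> : (eta + 1 / (eta * (s + eps))) / 2 -
   (2 * eps * ((eta + 1 / (eta * (s + 1))) / 2) +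
   (1 - 2 * eps) * ((eta + 1 / (eta * s)) / 2)) =
   eps * (s - 1 + 2 * eps) / (2 * eta * (s + eps) * (s + 1) * s).
  by field; rewrite !gt_eqF.
apply: divr_ge0; first by apply: mulr_ge0; lra.
by repeat (apply: mulr_ge0); lra.
Qed.

Section Concentration.
Context {R : realType} {I : Type} (p : I -> probability int R).
Context (i0 j0 : int) (eps : R).
Context (ij : i0 != j0) (eps_gt0 : 0 < eps).
Context (pi0 : forall i, eps <= fine (p i [set i0])).
Context (pj0 : forall i, eps <= fine (p i [set j0])).
Implicit Types (f : int -> R) (ii : seq I).

(** The expectation of f (y - S), for S the sum of the steps. *)
Fixpoint convolve ii f (y : int) : R :=
  if ii is i :: ii' then \int[p i]_z convolve ii' f (y - z) else f y.

(** [convolve] for one fair choice between i0 and j0. *)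
Definition avg f (y : int) : R := (f (y - i0) + f (y - j0)) / 2.

Lemma convolve_bound ii f (M : R) y : (forall z, 0 <= f z <= M) ->
  0 <= convolve ii f y <= M.
Proof.
move=> fM; elim: ii y => [|i ii IH] y /=; first exact: fM.
by apply: Rintegral_int_le_cst.
Qed.

Lemma convolve_integrable i ii f (M : R) (u : int -> int) :
  (forall z, 0 <= f z <= M) ->
  (p i).-integrable setT (EFin \o (fun z => convolve ii f (u z))).
Proof.
move=> fM; apply: (@integrable_int_bounded _ _ _ M) => z.
by have /andP[h1 h2] := @convolve_bound ii f M (u z) fM; rewrite ger0_norm.
Qed.

Lemma avg_bound f (M : R) : (forall z, 0 <= f z <= M) ->
  forall z, 0 <= avg f z <= M.
Proof.
move=> fM z; rewrite /avg; have /andP[? ?] := fM (z - i0).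
have /andP[? ?] := fM (z - j0); apply/andP; split; lra.
Qed.

Lemma convolve_avg ii f (M : R) y : (forall z, 0 <= f z <= M) ->
  convolve ii (avg f) y = avg (convolve ii f) y.
Proof.
move=> fM; elim: ii y => [//|i ii IH] y /=.
rewrite /avg -RintegralD//; try exact: (@convolve_integrable _ _ _ M).
rewrite mulrC -RintegralZl//; last first.
  by apply: integrable_intD; exact: (@convolve_integrable _ _ _ M).
apply: eq_Rintegral => z _; rewrite IH /avg mulrC.
by congr (_ * (convolve _ _ _ + convolve _ _ _)); ring.
Qed.

(** A law with mass at least eps at i0 and j0 is a mixture of the fair choice,
    with weight 2 eps, and of a remainder that is bounded by M. *)
Lemma Rintegral_split i f (M : R) : (forall z, 0 <= f z <= M) ->
  \int[p i]_z f z <= 2 * eps * ((f i0 + f j0) / 2) + (1 - 2 * eps) * M.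
Proof.
move=> fM.
pose q (a : int) (z : int) : R := - (M - f a) * (z == a)%:R.
have qi a : (p i).-integrable setT (EFin \o q a).
  apply: integrable_intZ; apply: (@integrable_int_bounded _ _ _ 1) => z.
  by case: (z == a); rewrite ?normr1 ?normr0.
have h1 : \int[p i]_z f z <= \int[p i]_z (M + (q i0 z + q j0 z)).
  apply: Rintegral_int_le.
  - move=> z; rewrite /q; have /andP[_ hM] := fM z.
    have [->|h1] := eqVneq z i0; have [h2|h2] := eqVneq _ j0.
    + by move: ij; rewrite h2 eqxx.
    + by rewrite mulr1 mulr0; lra.
    + by rewrite h2 mulr1 mulr0; lra.
    + by rewrite !mulr0; lra.
  - apply: (@integrable_int_bounded _ _ _ M) => z.
    by have /andP[? ?] := fM z; rewrite ger0_norm.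
  - apply: integrable_intD; first exact: integrable_int_cst.
    exact: integrable_intD.
have qsum := integrable_intD (qi i0) (qi j0).
rewrite (RintegralD _ (integrable_int_cst _ M) qsum)// in h1.
rewrite (RintegralD _ (qi i0) (qi j0))// in h1.
rewrite Rintegral_int_cst !Rintegral_int_atom in h1.
apply: (le_trans h1).
have /andP[_ hi] := fM i0; have /andP[_ hj] := fM j0.
have hi' : 0 <= M - f i0 by lra.
have hj' : 0 <= M - f j0 by lra.
have := ler_wpM2l hi' (pi0 i); have := ler_wpM2l hj' (pj0 i); lra.
Qed.

(** The number of words of length k over the letters i0 and j0 with sum y; it is
    a binomial coefficient, as the number of letters j0 is determined by y. *)
Fixpoint walks k (y : int) : nat :=
  if k is k'.+1 then (walks k' (y - i0) + walks k' (y - j0))%N else (y == 0).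

Lemma walks_support k y : walks k y != 0%N ->
  exists l : nat, y = k%:Z * i0 + l%:Z * (j0 - i0).
Proof.
elim: k y => [|k IH] y /=.
  by have [-> _|] := eqVneq y 0; [exists 0%N; rewrite !mul0r|].
rewrite addn_eq0 negb_and => /orP[/IH[l e]|/IH[l e]].
  by exists l; rewrite -(subrK i0 y) e intS; ring.
by exists l.+1; rewrite -(subrK j0 y) e !intS; ring.
Qed.

Lemma walks_bin k l : walks k (k%:Z * i0 + l%:Z * (j0 - i0)) = 'C(k, l).
Proof.
have d0 : j0 - i0 != 0 by rewrite subr_eq0 eq_sym.
elim: k l => [|k IH] l /=.
  rewrite mul0r add0r mulf_eq0 (negPf d0) orbF.
  by case: l => [|l] //.
have -> : k.+1%:Z * i0 + l%:Z * (j0 - i0) - i0 = k%:Z * i0 + l%:Z * (j0 - i0).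
  by rewrite intS; ring.
rewrite IH; case: l => [|l].
  rewrite bin0 (_ : walks _ _ = 0%N) ?bin0//.
  apply/eqP; rewrite -[_ == _]negbK; apply/negP => /walks_support[l hl].
  have : (l.+1%:Z * (j0 - i0)) = 0.
    move: hl; rewrite !intS => hl.
    by apply/eqP; rewrite -subr_eq0; move/eqP: hl; rewrite -subr_eq0 -oppr_eq0; congr (_ == _); ring.
  by move/eqP; rewrite mulf_eq0 (negPf d0) orbF.
rewrite binS; congr (_ + _)%N; rewrite -[RHS]IH; congr (walks k _).
by rewrite !intS; ring.
Qed.

Lemma walks_le k y : (walks k y <= 'C(k, k./2))%N.
Proof.
have [->//|/walks_support[l ->]] := eqVneq (walks k y) 0%N.
by rewrite walks_bin leq_bin_half.
Qed.

Definition unit_mass (y : int) : R := (y == 0)%:R.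

Lemma iter_avgE k y : iter k avg unit_mass y = (walks k y)%:R / 2 ^+ k.
Proof.
elim: k y => [|k IH] y /=; first by rewrite expr0 divr1.
by rewrite /avg !IH natrD exprS; field; rewrite expf_neq0.
Qed.

Lemma iter_avg_bound k y : 0 <= iter k avg unit_mass y <= 1.
Proof.
elim: k y => [|k IH] y /=; last exact: avg_bound.
by rewrite /unit_mass; case: (y == 0); rewrite ?lexx ler01.
Qed.

(** The square root is linearized: 2 a <= eta + a^2 / eta, with equality for
    eta = a.  This makes the bound on k fair choices linear in
    1 / (k + 1), which the induction of the next lemma can average. *)
Lemma iter_avg_le k y (eta : R) : 0 < eta ->
  iter k avg unit_mass y <= (eta + 1 / (eta * k.+1%:R)) / 2.
Proof.
move=> e0; rewrite iter_avgE.
have k0 : 0 < k.+1%:R :> R by rewrite ltr0n.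
have t0 : 0 < 2 ^+ k :> R by rewrite exprn_gt0.
set a := (walks k y)%:R / 2 ^+ k.
have a0 : 0 <= a by rewrite divr_ge0// ltW.
have h1 : a ^+ 2 * k.+1%:R <= 1.
  rewrite /a expr_div_n mulrAC ler_pdivrMr ?exprn_gt0// mul1r.
  rewrite -(natrX _ (walks k y) 2) -natrM -exprM [(k * 2)%N]mulnC exprM -(natrX _ 2 2) -natrX ler_nat.
  by apply: leq_trans (bin_half_sqr k); rewrite leq_mul2r leq_exp2r// walks_le orbT.
rewrite ler_pdivlMr//.
have h2 : 2 * a <= eta + a ^+ 2 / eta.
  rewrite -subr_ge0 (_ : _ - _ = (eta - a) ^+ 2 / eta); last by field; rewrite gt_eqF.
  by rewrite divr_ge0 ?sqr_ge0// ltW.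
rewrite mulrC; apply: (le_trans h2); rewrite lerD2l invfM mul1r mulrC ler_pM2l ?invr_gt0//.
by rewrite -[_^-1]mul1r ler_pdivlMr.
Qed.

(** Peeling off a step either turns it into one more fair choice, which commutes
    with the remaining convolutions and increases k, or drops it.  The expected
    gain of 2 eps in k is worth at least eps after convexity. *)
Lemma convolve_le ii k y (eta : R) : 0 < eta ->
  convolve ii (iter k avg unit_mass) y <=
    (eta + 1 / (eta * (eps * (size ii)%:R + k.+1%:R))) / 2.
Proof.
move=> e0; elim: ii k y => [|i ii IH] k y.
  by rewrite /= mulr0 add0r iter_avg_le.
have k0 : 1 <= k.+1%:R :> R by rewrite ler1n.
set s : R := eps * (size ii)%:R + k.+1%:R.
have s1 : 1 <= s.
  have : 0 <= eps * (size ii)%:R by apply: mulr_ge0 => //; exact: ltW.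
  by rewrite /s; lra.
set M := (eta + 1 / (eta * s)) / 2.
have hb z : 0 <= convolve ii (iter k avg unit_mass) (y - z) <= M.
  by rewrite IH andbT; case/andP: (@convolve_bound ii (iter k avg unit_mass) 1 (y - z) (@iter_avg_bound k)).
rewrite [convolve (i :: ii) _ _]/=; apply: le_trans (Rintegral_split i hb) _.
have h2 := IH k.+1 y.
rewrite /= (@convolve_avg _ _ 1) in h2; last exact: iter_avg_bound.
rewrite -/(avg (convolve ii (iter k avg unit_mass)) y).
have -> : eps * (size (i :: ii))%:R + k.+1%:R = s + eps.
  by rewrite /s /= -[(size ii).+1]addn1 natrD; ring.
have e1 : eps * (size ii)%:R + k.+2%:R = s + 1.
  by rewrite /s -[k.+2]addn1 natrD; ring.
rewrite e1 in h2.
apply: (@le_trans _ _ (2 * eps * ((eta + 1 / (eta * (s + 1))) / 2) + (1 - 2 * eps) * M)).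
  by rewrite lerD2r; apply: ler_wpM2l; [by apply: mulr_ge0 => //; exact: ltW|exact: h2].
exact: recip_mix_le.
Qed.

(** The choice of eta that balances the two terms of [convolve_le]. *)
Lemma convolve_sqrt ii y : convolve ii unit_mass y <=
  1 / Num.sqrt (eps * (size ii)%:R + 1).
Proof.
set t : R := eps * _ + 1.
have t0 : 0 < t by rewrite /t ltr_wpDl// mulr_ge0// ltW.
have s0 : 0 < Num.sqrt t by rewrite sqrtr_gt0.
have e0 : 0 < (Num.sqrt t)^-1 by rewrite invr_gt0.
have := @convolve_le ii 0 y _ e0; rewrite -/t /=.
suff -> : ((Num.sqrt t)^-1 + 1 / ((Num.sqrt t)^-1 * t)) / 2 = 1 / Num.sqrt t by [].
move: s0 (sqr_sqrtr (ltW t0)); move: (Num.sqrt t) => q q0 <-.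
by field; rewrite gt_eqF.
Qed.

Lemma sum_concentration ii (r : R) :
  iter_expect p ii (fun s => ((\sum_(z <- s) z%:~R == r :> R))%:R) <=
  1 / Num.sqrt (eps * (size ii)%:R + 1).
Proof.
have [[y <-]|hr] := pselect (exists y : int, y%:~R = r).
  have -> : iter_expect p ii (fun s => (\sum_(z <- s) z%:~R == y%:~R :> R)%:R) = convolve ii unit_mass y.
    elim: ii y => [|i ii IH] y /=.
      by rewrite big_nil /unit_mass -[0]/(0%:~R) eqr_int eq_sym.
    apply: eq_Rintegral => z _; rewrite -IH; congr iter_expect; apply/funext => s.
    by rewrite big_cons rmorphB/= [in RHS]eq_sym subr_eq addrC eq_sym.
  exact: convolve_sqrt.
have -> : iter_expect p ii (fun s => (\sum_(z <- s) z%:~R == r :> R)%:R) = 0.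
  apply/eqP; rewrite eq_le andbC; apply: iter_expect_bound => s.
  case: eqP => [e|]; last by rewrite lexx.
  by case: hr; exists (\sum_(z <- s) z); rewrite rmorph_sum.
by rewrite divr_ge0// sqrtr_ge0.
Qed.

End Concentration.

(** * Laws of finite families of independent integer variables *)

Section IndependentFamily.
Context {R : realType} {d : measure_display} {T : measurableType d}.
Context (P : probability T R) (n : nat) (X : 'I_n -> {RV P >-> int}).
Implicit Types (ii : seq 'I_n) (A : seq int -> Prop).

Local Notation values ii w := [seq X i w | i <- ii].

Lemma preimage_int_measurable i (B : set int) : measurable (X i @^-1` B).
Proof. by rewrite -[X in measurable X]setTI; exact: measurable_funP. Qed.

Lemma values_measurable ii A : measurable [set w | A (values ii w)].
Proof.
elim: ii A => [|i ii IH] A /=.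
  have [a|a] := pselect (A [::]).
    by rewrite (_ : [set w | _] = setT)//; apply/seteqP; split.
  by rewrite (_ : [set w | _] = set0)//; apply/seteqP; split.
rewrite (_ : [set w | _] = \bigcup_k (X i @^-1` int_cell k `&`
    [set w | A (X i w :: values ii w)])); last first.
  by rewrite -setI_bigcupl -preimage_bigcup int_cell_cover preimage_setT setTI.
apply: bigcupT_measurable => k.
have [->|[z ->]] := int_cellP k; first by rewrite preimage_set0 set0I.
rewrite (_ : _ `&` _ = X i @^-1` [set z] `&` [set w | A (z :: values ii w)]).
  apply: measurableI; first exact: preimage_int_measurable.
  exact: IH (fun s => A (z :: s)).
by apply/seteqP; split => w [/= <-].
Qed.

Context (indep : mutually_independent X).


Lemma cylinder_bigcap (jj : seq 'I_n) (b : 'I_n -> int) :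
  [set w | values jj w = map b jj] =
  \bigcap_(i in [set i | i \in [set j in jj]%SET]) (X i @^-1` [set b i]).
Proof.
apply/seteqP; split => w /=.
  by move/eq_in_map => h i /=; rewrite inE => ij; exact: h.
by move=> h; apply/eq_in_map => i ij; apply: h; rewrite /= inE.
Qed.

Lemma cylinder_prod (jj : seq 'I_n) (b : 'I_n -> int) :
  P [set w | values jj w = map b jj] =
  (\prod_(i in [set j in jj]%SET) P (X i @^-1` [set b i]))%E.
Proof. by rewrite cylinder_bigcap; apply: indep. Qed.

Lemma cylinder_rcons (jj : seq 'I_n) (ys : seq int) i z : uniq (rcons jj i) ->
  P [set w | values (rcons jj i) w = rcons ys z] =
  (P [set w | values jj w = ys] * P (X i @^-1` [set z]))%E.
Proof.
move=> u.
have [sz|sz] := eqVneq (size ys) (size jj); last first.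
  rewrite (_ : [set w | values (rcons jj i) w = _] = set0); last first.
    apply/seteqP; split => w //= /(congr1 size); rewrite size_map !size_rcons.
    by case=> e; move: sz; rewrite e eqxx.
  rewrite (_ : [set w | values jj w = _] = set0) ?measure0 ?mul0e//.
  apply/seteqP; split => w //= /(congr1 size); rewrite size_map.
  by move=> e; move: sz; rewrite e eqxx.
have [b bE] : exists b : 'I_n -> int, map b (rcons jj i) = rcons ys z.
  exists (fun j => nth 0 (rcons ys z) (index j (rcons jj i))).
  apply: (@eq_from_nth _ 0); first by rewrite size_map !size_rcons sz.
  move=> k; rewrite size_map => kl.
  by rewrite (nth_map i)// index_uniq.
have : rcons (map b jj) (b i) = rcons ys z by rewrite -map_rcons.
case/rcons_inj => <- <-; rewrite -map_rcons !cylinder_prod.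
rewrite (_ : [set j in rcons jj i]%SET = (i |: [set j in jj])%SET); last first.
  by apply/setP => j; rewrite !inE mem_rcons.
by rewrite big_setU1 1?muleC// inE; move: u; rewrite rcons_uniq => /andP[].
Qed.

(** Induction on the list of variables whose values are still free; the values
    ys of the variables jj are already fixed.  Independence is used in
    [cylinder_rcons], to move one variable from ii to jj. *)
Lemma cylinder_iter_expect (jj : seq 'I_n) (ys : seq int) ii A : uniq (jj ++ ii) ->
  P [set w | values jj w = ys /\ A (values ii w)] =
  (P [set w | values jj w = ys] *
   (iter_expect (fun i => distribution P (X i)) ii (fun s => (`[< A s >])%:R))%:E)%E.
Proof.
elim: ii jj ys A => [|i ii IH] jj ys A u /=.
  case: asboolP => a; rewrite ?mule1 ?mule0.
    by congr (P _); apply/seteqP; split => w //= [].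
  by rewrite (_ : [set w | _] = set0) ?measure0//; apply/seteqP; split => w //= [].
rewrite (_ : [set w | _] = \bigcup_k (X i @^-1` int_cell k `&`
    [set w | values jj w = ys /\ A (X i w :: values ii w)])); last first.
  by rewrite -setI_bigcupl -preimage_bigcup int_cell_cover preimage_setT setTI.
have mset k : measurable (X i @^-1` int_cell k `&`
    [set w | values jj w = ys /\ A (X i w :: values ii w)]).
  apply: measurableI; first exact: preimage_int_measurable.
  apply: (@measurableI _ _ [set w | values jj w = ys] [set w | A (X i w :: values ii w)]).
    exact: (values_measurable jj (fun s => s = ys)).
  exact: (values_measurable (i :: ii) A).
rewrite measure_bigcup//; last first.
  apply/trivIsetP => a b _ _ ab; rewrite -subset0 => w /= [[h1 _] [h2 _]].
  by move: ab; rewrite -h1 -h2 eqxx.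
pose F z := iter_expect (fun i => distribution P (X i)) ii (fun s => (`[< A (z :: s) >])%:R) : R.
have F01 z : 0 <= F z <= 1 by apply: iter_expect_bound => s; exact: natr_bool_bound.
rewrite -/F /Rintegral fineK; last first.
  by apply: integrable_fin_num => //; apply: (@iter_expect_integrable _ _ _ i ii (fun s => (`[< A s >])%:R) 1) => s; exact: natr_bool_bound.
rewrite ge0_integral_int_cells; last by move=> z; case/andP: (F01 z).
have [r rE] : exists r : R, P [set w | values jj w = ys] = r%:E.
  by exists (fine (P [set w | values jj w = ys])); rewrite fineK// fin_num_measure//; exact: (values_measurable jj (fun s => s = ys)).
rewrite rE -nneseriesZl; last first.
  by move=> k _; apply: integral_ge0 => z _; rewrite lee_fin; case/andP: (F01 z).
rewrite (eq_eseriesl (Q := xpredT)); last by move=> k; rewrite in_setT.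
apply: eq_eseriesr => k _.
have [->|[z ->]] := int_cellP k.
  by rewrite preimage_set0 set0I measure0 integral_set0 mule0.
have -> : (\int[distribution P (X i)]_(y in [set z]) (F y)%:E =
   P (X i @^-1` [set z]) * (F z)%:E)%E.
  by rewrite integral_int_set1 muleC.
rewrite -rE muleA -cylinder_rcons; last first.
  by move: u; rewrite -cat_rcons cat_uniq => /andP[].
rewrite -IH ?cat_rcons//; congr (P _); apply/seteqP; split => w /=.
  by move=> [h1 [<- h2]]; rewrite map_rcons h1; rewrite h1 in h2.
move=> [h1 h2]; move: h1; rewrite map_rcons => h1; have [h3 h4] := rcons_inj h1.
by rewrite h3 h4 in h2 *.
Qed.

(** The list ii may enumerate the variables in any order; this allows for time
    reversal, and for moving the middle block to the end. *)
Lemma prob_values ii A : uniq ii ->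
  P [set w | A (values ii w)] =
  (iter_expect (fun i => distribution P (X i)) ii (fun s => (`[< A s >])%:R))%:E.
Proof.
move=> u; rewrite (_ : [set w | A (values ii w)] =
    [set w | values [::] w = [::] /\ A (values ii w)]); last first.
  by apply/seteqP; split => [w /= h|w []].
rewrite cylinder_iter_expect// (_ : [set w | _] = setT) ?probability_setT ?mul1e//.
by apply/seteqP; split.
Qed.

End IndependentFamily.

(** * Consequences of belonging to the law class *)

Section LawClass.
Context {R : realType}.
Implicit Types (p : probability int R).

Lemma nstep_ge0 p n x y : (0 <= nstep (walk_kernel p) n x y)%E.
Proof.
elim: n x => [|n IH] x /=; first by rewrite lee_fin.
by apply: esum_ge0 => z _; apply: mule_ge0.
Qed.

(** A set of states closed under the steps of positive probability cannot be
    left. *)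
Lemma nstep_invariant p (C : int -> Prop) n x y :
  (forall z i : int, C z -> p [set i] != 0%E -> C (z + i)) ->
  C x -> (0 < nstep (walk_kernel p) n x y)%E -> C y.
Proof.
move=> stepC; elim: n x => [|n IH] x Cx /=.
  by rewrite lte_fin ltr0n lt0b => /eqP <-.
have [//|nCy] := pselect (C y).
rewrite esum1 ?ltxx// => z _.
have [/eqP|pz] := boolP (walk_kernel p x z == 0%E); first by move=> ->; rewrite mul0e.
have Cz : C z by have := stepC x (z - x) Cx pz; rewrite addrC subrK.
apply/eqP; rewrite mule_eq0 (negPf pz)/= eq_le nstep_ge0 andbT leNgt.
by apply/negP => /(IH z Cz).
Qed.

(** From 0 the walk must be able to reach 1 and -1, so that it charges a
    positive and a negative integer. *)
Lemma irreducible_two_atoms p : irreducible_law p ->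
  exists i j : int, [/\ i != j, (p [set i] != 0)%E & (p [set j] != 0)%E].
Proof.
move=> irr.
have [i i0 pi] : exists2 i : int, 0 < i & (p [set i] != 0)%E.
  apply: contrapT => h; have [m hm] := irr 0 1.
  suff : (1 : int) <= 0 by [].
  apply: (@nstep_invariant p (fun z => z <= 0) m 0 1 _ (lexx _) hm) => z i z0 pi.
  have [i0|i0] := leP i 0; first by rewrite -[0]addr0 lerD.
  by case: h; exists i.
have [j j0 pj] : exists2 j : int, j < 0 & (p [set j] != 0)%E.
  apply: contrapT => h; have [m hm] := irr 0 (-1).
  suff : 0 <= (-1 : int) by [].
  apply: (@nstep_invariant p (fun z => 0 <= z) m 0 (-1) _ (lexx _) hm) => z j z0 pj.
  have [j0|j0] := leP 0 j; first by rewrite -[0]addr0 lerD.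
  by case: h; exists j.
by exists i, j; split => //; rewrite gt_eqF// (lt_trans j0).
Qed.

Lemma irreducible_seq_atoms (a : int -> R) : (forall i, 0 <= a i <= 1) ->
  irreducible_aperiodic_seq a ->
  exists i j : int, [/\ i != j, 0 < a i & 0 < a j].
Proof.
move=> a01 [p [irr _] [b ab]].
have [i [j [ij pi pj]]] := irreducible_two_atoms irr.
have pos k : p [set k] != 0%E -> 0 < a k.
  move=> pk; have /andP[ak _] := a01 k; have [bk e] := ab k.
  rewrite lt_neqAle ak andbT; apply: contra_neq pk => a0.
  by move/esym/eqP: e; rewrite -a0 mule_eq0 eqe gt_eqF//= => /eqP.
by exists i, j; split => //; exact: pos.
Qed.

Context (c0 delta : R) (a : int -> R).
Context (delta_gt0 : 0 < delta).

Lemma law_class_exp p t : law_class a delta c0 p -> `|t| <= delta ->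
  p.-integrable setT (EFin \o (fun z : int => expR (t * z%:~R))) /\
  \int[p]_z expR (t * z%:~R) <= c0.
Proof.
move=> [h _] td.
have e : (\int[p]_z (expR (t * z%:~R))%:E <= c0%:E)%E.
  rewrite ge0_integral_int_esum; last by move=> z; exact: expR_ge0.
  by apply: le_trans h; apply: ereal_sup_ubound; exists t.
have pi : p.-integrable setT (EFin \o (fun z : int => expR (t * z%:~R))).
  apply/integrableP; split => //.
  rewrite (eq_integral (fun z : int => (expR (t * z%:~R))%:E)); last first.
    by move=> z _; rewrite /= ger0_norm ?expR_ge0.
  exact: le_lt_trans e (ltry _).
split => //; rewrite -lee_fin /Rintegral fineK//.
exact: integrable_fin_num.
Qed.

Definition mean p : R := \int[p]_z z%:~R.

(** A bound for exp(delta |z|) whose expectation is controlled by the two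
    exponential moments at delta and - delta. *)
Definition two_sided (z : int) : R :=
  expR (delta * z%:~R) + expR (- delta * z%:~R).

Lemma two_sidedP p : law_class a delta c0 p ->
  p.-integrable setT (EFin \o two_sided) /\ \int[p]_z two_sided z <= 2 * c0.
Proof.
move=> pc.
have [i1 h1] := law_class_exp (t := delta) pc ltac:(by rewrite ger0_norm// ltW).
have [i2 h2] := law_class_exp (t := - delta) pc ltac:(by rewrite normrN ger0_norm// ltW).
split; first exact: integrable_intD.
by rewrite /two_sided RintegralD//; lra.
Qed.

Lemma expR_norm_le_two_sided (z : int) : expR (delta * `|z%:~R|) <= two_sided z.
Proof.
have h1 := expR_ge0 (delta * z%:~R); have h2 := expR_ge0 (- delta * z%:~R).
have [h|h] := leP 0 (z%:~R : R); rewrite /two_sided.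
  by rewrite ger0_norm//; lra.
by rewrite ltr0_norm// mulrN -mulNr; lra.
Qed.

Lemma mean_int p : law_class a delta c0 p ->
  p.-integrable setT (EFin \o (fun z : int => z%:~R : R)).
Proof.
move=> pc; have [i1 _] := two_sidedP pc.
apply: (le_integrable_int (g := fun z => delta^-1 * two_sided z)).
  move=> z; apply: le_trans (le_expR_div _ delta_gt0) _.
  by rewrite mulrC ler_pM2l ?invr_gt0//; exact: expR_norm_le_two_sided.
exact: integrable_intZ.
Qed.

Lemma mean_bound p : law_class a delta c0 p -> `|mean p| <= 2 * c0 / delta.
Proof.
move=> pc; have [i1 h1] := two_sidedP pc.
have i2 := integrable_intZ delta^-1 i1.
apply: le_trans (le_normr_Rintegral _ (mean_int pc)) _ => //.
apply: (@le_trans _ _ (\int[p]_z (delta^-1 * two_sided z))).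
  apply: Rintegral_int_le => //.
    move=> z; apply: le_trans (le_expR_div _ delta_gt0) _.
    by rewrite mulrC ler_pM2l ?invr_gt0//; exact: expR_norm_le_two_sided.
  apply: le_integrable_int i2 => z; rewrite normr_id.
  apply: le_trans (le_expR_div _ delta_gt0) _.
  by rewrite mulrC ler_pM2l ?invr_gt0//; exact: expR_norm_le_two_sided.
by rewrite RintegralZl// mulrC ler_wpM2r// invr_ge0 ltW.
Qed.

Context (i0 j0 : int) (eps : R).
Context (ij : i0 != j0) (eps_gt0 : 0 < eps) (ai : eps <= a i0) (aj : eps <= a j0).

Lemma law_class_atom p k : law_class a delta c0 p -> eps <= a k ->
  eps <= fine (p [set k]).
Proof.
move=> [_ h] ek; rewrite -lee_fin fineK ?fin_num_measure//.
by apply: le_trans (h k); rewrite lee_fin.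
Qed.

(** The variance is bounded below because the mean cannot be close to both
    integers i0 and j0. *)
Lemma law_class_good p : law_class a delta c0 p ->
  good_step delta (eps / 2) (expR (delta * (2 * c0 / delta)) * (2 * c0))
    p (fun z => z%:~R - mean p).
Proof.
move=> pc; have [i1 h1] := two_sidedP pc; have mb := mean_bound pc.
set W := expR (delta * (2 * c0 / delta)); have W0 : 0 < W by exact: expR_gt0.
have i2 := integrable_intZ W i1.
have le1 z : expR (delta * `|z%:~R - mean p|) <= W * two_sided z.
  apply: (@le_trans _ _ (expR (delta * (2 * c0 / delta) + delta * `|z%:~R|))).
    apply: expR_le; rewrite -mulrDr ler_pM2l//.
    by apply: le_trans (ler_normB _ _) _; rewrite addrC lerD2r.
  by rewrite expRD ler_pM2l// expR_norm_le_two_sided.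
have i3 : p.-integrable setT
    (EFin \o (fun z : int => expR (delta * `|z%:~R - mean p|))).
  apply: le_integrable_int i2 => z.
  by rewrite ger0_norm ?expR_ge0.
have im := integrable_int_cst p (mean p).
have i4 : p.-integrable setT (EFin \o (fun z : int => (z%:~R - mean p) ^+ 2)).
  apply: (le_integrable_int (g := fun z => 2 / delta ^+ 2 * expR (delta * `|z%:~R - mean p|))).
    by move=> z; rewrite normrX; exact: le_sqr_expR.
  exact: integrable_intZ.
split => //.
- apply: (@le_trans _ _ (\int[p]_z (W * two_sided z))).
    exact: Rintegral_int_le.
  by rewrite RintegralZl// ler_pM2l.
- by rewrite RintegralB ?Rintegral_int_cst ?subrr//; exact: mean_int.
- pose s (k : int) : R := (k%:~R - mean p) ^+ 2.
  have s0 k : 0 <= s k by exact: sqr_ge0.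
  have qi k : p.-integrable setT (EFin \o (fun z : int => s k * (z == k)%:R)).
    apply: integrable_intZ; apply: (@integrable_int_bounded _ _ _ 1) => z.
    by case: (z == k); rewrite ?normr1 ?normr0.
  apply: (@le_trans _ _ (\int[p]_z (s i0 * (z == i0)%:R + s j0 * (z == j0)%:R))).
    rewrite (RintegralD _ (qi i0) (qi j0))// !Rintegral_int_atom.
    have hi := ler_wpM2l (s0 i0) (law_class_atom pc ai).
    have hj := ler_wpM2l (s0 j0) (law_class_atom pc aj).
    have hs : 1 / 2 <= s i0 + s j0.
      have : 1 <= ((i0 - j0)%:~R : R) ^+ 2.
        have : 1 <= `|(i0 - j0)%:~R| :> R.
          rewrite -intr_norm ler1z.
          by have : 0 < `|i0 - j0| by rewrite normr_gt0 subr_eq0.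
        by move=> h; rewrite -real_normK ?num_real// exprn_ege1.
      have : 0 <= (i0%:~R + j0%:~R - 2 * mean p) ^+ 2 by exact: sqr_ge0.
      rewrite rmorphB /s /=; nra.
    have := ler_wpM2l (ltW eps_gt0) hs; lra.
  apply: Rintegral_int_le => //; last exact: integrable_intD.
  move=> z.
  have [->|h1'] := eqVneq z i0; have [h2|h2] := eqVneq _ j0.
  + by move: ij; rewrite h2 eqxx.
  + by rewrite mulr1 mulr0 addr0.
  + by rewrite h2 mulr1 mulr0 add0r.
  + by rewrite !mulr0 addr0; exact: sqr_ge0.
Qed.

End LawClass.

(** * Uniform survival bound and splitting into three blocks *)

Section Assembly.
Context {R : realType}.

(** theta is taken small for the cubic error of [lyap_step], then A large for
    the undershoot, then lam large for the overshoot. *)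
Lemma lyap_constants (del s2 K : R) : 0 < del -> 0 < s2 -> 0 < K ->
  exists th A lam0 : R, [/\ 0 < th, 2 * th <= del, 2 <= A & 1 <= lam0] /\
    [/\ K * (th ^+ 3 * (6 / 27) / del ^+ 3 + lyapB th ^+ 2 / (4 * A)) <=
          th ^+ 2 / 3 * s2 &
        forall lam, lam0 <= lam -> 12 / (lam * del ^+ 3) * K <= s2 / 4].
Proof.
move=> d0 s0 K0; have d30 : 0 < del ^+ 3 by exact: exprn_gt0.
pose th := Num.min (del / 2) (del ^+ 3 * s2 / (2 * K)).
have th0 : 0 < th.
  by rewrite lt_min divr_gt0//= divr_gt0 ?mulr_gt0.
have th1 : th <= del / 2 by rewrite ge_min lexx.
have th2 : th * (2 * K) <= del ^+ 3 * s2.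
  by rewrite -ler_pdivlMr ?mulr_gt0// ge_min lexx orbT.
clearbody th; have th20 : 0 < th ^+ 2 by exact: exprn_gt0.
set B := lyapB th ^+ 2; have B0 : 0 <= B by exact: sqr_ge0.
pose q := 3 * K * B / (2 * th ^+ 2 * s2).
have q0 : 0 <= q.
  by apply: divr_ge0; repeat (apply: mulr_ge0 => //); exact: ltW.
pose l0 := 48 * K / (del ^+ 3 * s2).
have l00 : 0 <= l0.
  by apply: divr_ge0; repeat (apply: mulr_ge0 => //); exact: ltW.
exists th, (2 + q), (1 + l0); split; first by split; lra.
split.
  have h1 : K * (th ^+ 3 * (6 / 27) / del ^+ 3) <= th ^+ 2 * s2 / 6.
    rewrite mulrA ler_pdivrMr//.
    have -> : K * (th ^+ 3 * (6 / 27)) = th ^+ 2 / 9 * (th * (2 * K)) by field.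
    apply: (@le_trans _ _ (th ^+ 2 / 9 * (del ^+ 3 * s2))).
      by rewrite ler_wpM2l// divr_ge0// ltW.
    rewrite [X in _ <= X](_ : _ = th ^+ 2 / 6 * (del ^+ 3 * s2)); last by field.
    apply: ler_wpM2r; first by apply: mulr_ge0; exact: ltW.
    lra.
  have h2 : K * (B / (4 * (2 + q))) <= th ^+ 2 * s2 / 6.
    have q4 : 0 < 4 * (2 + q) by apply: mulr_gt0 => //; apply: ltr_pwDl.
    rewrite mulrA ler_pdivrMr//.
    have -> : th ^+ 2 * s2 / 6 * (4 * (2 + q)) = th ^+ 2 * s2 * (4 / 3) + K * B.
      by rewrite /q; field; rewrite !gt_eqF.
    by rewrite lerDr; repeat (apply: mulr_ge0 => //); exact: ltW.
  rewrite mulrDr; apply: le_trans (lerD h1 h2) _.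
  by rewrite le_eqVlt; apply/orP; left; apply/eqP; field.
move=> lam hl.
have lam0 : 0 < lam by apply: lt_le_trans hl; exact: ltr_pwDl.
rewrite mulrAC ler_pdivrMr ?mulr_gt0//.
have -> : 12 * K = s2 / 4 * (l0 * del ^+ 3) by rewrite /l0; field; rewrite !gt_eqF.
apply: ler_wpM2l; first by rewrite divr_ge0// ltW.
by apply: ler_wpM2r; [exact: ltW|apply: le_trans hl; rewrite lerDr].
Qed.

Lemma half_bounds (m : nat) : (2 <= m)%N ->
  [/\ (m./2 < m)%N, (m <= m./2 * 3)%N & (m <= (m - m./2) * 2)%N].
Proof. by move=> m2; split; lia. Qed.

(** The constants depend on the moments of the steps only. *)
Lemma survival_uniform (del s2 K : R) : 0 < del -> 0 < s2 -> 0 < K ->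
  exists Cs cs lam0 : R, [/\ 0 < Cs, 0 < cs & 1 <= lam0] /\
  forall (I : Type) (p : I -> probability int R) (g : I -> int -> R),
  (forall i, good_step del s2 K (p i) (g i)) ->
  forall (lam x : R) (ii : seq I), lam0 <= lam -> band lam x ->
  (2 <= size ii)%N -> lam ^+ 2 <= 4 * (size ii)%:R ->
  survival p lam g x ii <= Cs * (Num.min x (lam - x) + 1) / lam *
     expR (- (cs * (size ii)%:R / lam ^+ 2)).
Proof.
move=> d0 s0 K0.
have [th [A [lam0 [[th0 thd A2 l1] [hK hl]]]]] := lyap_constants d0 s0 K0.
pose c1 := s2 / 4; have c10 : 0 < c1 by rewrite divr_gt0.
exists (8 * A / c1), (c1 / (3 * (1 + A))), lam0; split.
  by split => //; apply: divr_gt0 => //; lra.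
suff one (I : Type) (p : I -> probability int R) (g : I -> int -> R) :
  (forall i, good_step del s2 K (p i) (g i)) ->
  forall (lam x : R) (ii : seq I), lam0 <= lam -> band lam x ->
  (2 <= size ii)%N -> lam ^+ 2 <= 4 * (size ii)%:R ->
  survival p lam g x ii <= 8 * A / c1 * (x + 1) / lam *
     expR (- (c1 / (3 * (1 + A)) * (size ii)%:R / lam ^+ 2)).
  move=> I p g gs lam x ii ll xb s1 s4; case: (leP x (lam - x)) => _.
    exact: one.
  rewrite -survival_reflect; apply: one => //; last by rewrite band_reflect.
  by move=> i; exact: good_stepN.
move=> gs lam x ii ll xb m2 m4; set m := size ii in m2 m4 *.
have lam1 : 1 <= lam by lra.
have lamp : 0 < lam by lra.
have lam2 : 0 < lam ^+ 2 by exact: exprn_gt0.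
pose Hm := (1 + A) * lam ^+ 2.
have Hm0 : 0 < Hm by apply: mulr_gt0 => //; lra.
have hb y : band lam y -> 0 <= lyap th A lam y <= Hm.
  move=> yb; have /andP[-> _] := lyap_bounds th0 A2 lam1 yb.
  exact: lyap_le_max.
have hd i y : band lam y ->
  \int[p i]_z ((band lam (y + g i z))%:R * lyap th A lam (y + g i z)) <=
    lyap th A lam y - c1.
  by move=> yb; apply: (lyap_drift th0 thd A2 lam1 yb hK (hl _ ll) (gs i)).
have [km m3 m1] := half_bounds m2.
have := survival_exp_bound c10 Hm0 hb hd xb km.
rewrite -/m => /le_trans; apply.
have k3 : m%:R / 3 <= (m./2)%:R :> R.
  by rewrite ler_pdivrMr// -natrM ler_nat.
have k2 : m%:R / 2 <= (m - m./2)%:R :> R.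
  by rewrite ler_pdivrMr// -natrM ler_nat.
have mk0 : 0 < (m - m./2)%:R :> R by rewrite ltr0n subn_gt0.
have /andP[h0 h1] := lyap_bounds th0 A2 lam1 xb.
have /andP[x0 xl] := xb.
have h2 : lyap th A lam x <= A * lam * (x + 1).
  apply: (le_trans h1); rewrite [A * lam]mulrC -mulrA ler_pM2l//.
  have : 0 <= (A - 1) * x by apply: mulr_ge0; lra.
  lra.
have h3 : lyap th A lam x / (c1 * (m - m./2)%:R) <= 8 * A / c1 * (x + 1) / lam.
  rewrite ler_pdivrMr ?mulr_gt0//.
  have -> : 8 * A / c1 * (x + 1) / lam * (c1 * (m - m./2)%:R) =
     A * (x + 1) / lam * (8 * (m - m./2)%:R) by field; rewrite !gt_eqF.
  apply: (le_trans h2).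
  have -> : A * lam * (x + 1) = A * (x + 1) / lam * lam ^+ 2 by field; rewrite gt_eqF.
  apply: ler_wpM2l; last by lra.
  by rewrite !mulr_ge0// ?invr_ge0; lra.
rewrite -mulrA mulrC; apply: ler_pM => //; try exact: expR_ge0.
  by apply: divr_ge0 => //; apply: mulr_ge0; exact: ltW.
apply: expR_le; rewrite lerN2.
have -> : c1 / (3 * (1 + A)) * m%:R / lam ^+ 2 = c1 / Hm * (m%:R / 3).
  by rewrite /Hm; field; rewrite !gt_eqF//; lra.
by apply: ler_wpM2l => //; apply: divr_ge0; exact: ltW.
Qed.

(** Integrating the block ii2 last, given the values s1 and s3 of the others. *)
Lemma iter_expect_three_blocks (I : Type) (p : I -> probability int R) (ii1 ii2 ii3 : seq I)
    (A a1 a3 : seq int -> bool) (r : seq int -> seq int -> R) (kap : R) :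
  (forall s1 s3 s2, size s1 = size ii1 -> size s3 = size ii3 ->
     A (s1 ++ s3 ++ s2) ->
     [/\ a1 s1, a3 s3 & \sum_(z <- s2) z%:~R = r s1 s3]) ->
  (forall x : R, iter_expect p ii2 (fun s => (\sum_(z <- s) z%:~R == x)%:R) <= kap) ->
  iter_expect p (ii1 ++ ii3 ++ ii2) (fun s => (A s)%:R) <=
  kap * iter_expect p ii1 (fun s => (a1 s)%:R) * iter_expect p ii3 (fun s => (a3 s)%:R).
Proof.
move=> H hk.
have b01 (b : bool) : 0 <= (b%:R : R) <= 1 by exact: natr_bool_bound.
have eb ii (B : seq int -> bool) : 0 <= iter_expect p ii (fun s => (B s)%:R) <= 1.
  by apply: iter_expect_bound.
have k0 : 0 <= kap by apply: le_trans (hk 0); case/andP: (eb ii2 (fun s => \sum_(z <- s) z%:~R == 0 :> R)).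
have kb (b : bool) (M : R) : 0 <= M -> kap <= M -> 0 <= kap * b%:R <= M.
  by case: b => M0 kM; rewrite ?mulr1 ?mulr0 ?lexx ?M0 ?k0 ?kM.
have step3 s1 : size s1 = size ii1 ->
   iter_expect p ii3 (fun s3 => iter_expect p ii2 (fun s2 => (A (s1 ++ s3 ++ s2))%:R)) <=
   (a1 s1)%:R * (kap * iter_expect p ii3 (fun s => (a3 s)%:R)).
  move=> z1; rewrite -(@iter_expectZ _ _ _ _ _ _ 1)// -(@iter_expectZ _ _ _ _ _ _ (kap + 1)); last by move=> s; apply: kb; lra.
  apply: (@iter_expect_le _ _ _ _ _ _ (kap + 1)).
  - move=> s3; have /andP[h1 h2] := eb ii2 (fun s2 => A (s1 ++ s3 ++ s2)).
    by rewrite h1/= (le_trans h2)// lerDr.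
  - by move=> s3; case: (a1 s1); rewrite ?mul1r ?mul0r ?lexx; [apply: kb|]; lra.
  - move=> s3 z3.
    have [h|h] := boolP (a1 s1 && a3 s3).
      move: h => /andP[-> ->]; rewrite mul1r mulr1; apply: le_trans (hk (r s1 s3)).
      apply: (@iter_expect_le _ _ _ _ _ _ 1) => // s2 _.
      have [h|h] := boolP (A _); last by case/andP: (b01 (\sum_(z <- s2) z%:~R == r s1 s3)).
      by have [_ _ ->] := H _ _ _ z1 z3 h; rewrite eqxx.
    have -> : (a1 s1)%:R * (kap * (a3 s3)%:R) = 0 :> R.
      by move: h; case: (a1 s1) (a3 s3) => -[]; rewrite ?mulr0 ?mul0r.
    have /andP[] // : 0 <= iter_expect p ii2 (fun s2 => (A (s1 ++ s3 ++ s2))%:R : R) <= 0.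
    apply: iter_expect_bound => s2; have [h'|h'] := boolP (A _); last by rewrite lexx.
    by have [h1 h2 _] := H _ _ _ z1 z3 h'; rewrite h1 h2 in h.
set e3 := iter_expect p ii3 (fun s => (a3 s)%:R) in step3 *.
have /andP[e30 e31] : 0 <= e3 <= 1 by exact: eb.
have ke0 : 0 <= kap * e3 by exact: mulr_ge0.
rewrite -mulrA [iter_expect p ii1 _ * _]mulrC mulrA -(@iter_expectZ _ _ _ _ _ _ 1)//.
rewrite iter_expect_cat; apply: (@iter_expect_le _ _ _ _ _ _ (kap * e3 + 1)).
- move=> s1; have /andP[h1 h2] := eb (ii3 ++ ii2) (fun s => A (s1 ++ s)).
  by rewrite h1/= (le_trans h2)// lerDr.
- by move=> s1; case: (a1 s1); rewrite ?mulr1 ?mulr0; lra.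
- by move=> s1 z1; rewrite iter_expect_cat mulrC; exact: step3.
Qed.

End Assembly.

(** * Splitting the event of the theorem *)

Section WalkOnLists.
Context {R : realType}.

Lemma stay_values (I : Type) (g : I -> int -> R) (lam x : R) (ii : seq I)
    (f : I -> int) :
  (forall k, (0 < k <= size ii)%N ->
     band lam (x + \sum_(i <- take k ii) g i (f i))) ->
  stay lam g x ii (map f ii).
Proof.
elim: ii x => [//|i ii IH] x H /=.
have := H 1%N isT; rewrite /= take0 big_seq1 => -> /=.
apply: IH => k /andP[k0 kl].
by have := H k.+1; rewrite /= big_cons addrA; apply.
Qed.

Lemma sum_ord_ltn n k (F : 'I_n -> R) :
  \sum_(i < n | (i < k)%N) F i = \sum_(i <- take k (enum 'I_n)) F i.
Proof.
rewrite -big_filter [index_enum _]unlock -enumT; congr bigop; apply: (inj_map val_inj).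
rewrite map_take val_enum_ord -[RHS]filter_predT.
rewrite -(filter_map _ (fun j => j < k)%N) val_enum_ord take_iota filter_predT.
have [kn|nk] := leqP k n.
  by rewrite (filter_iota_ltn 0).
apply/all_filterP/allP => j.
by rewrite mem_iota => /andP[_ jn]; apply: ltn_trans nk.
Qed.

Lemma perm_blocks (T : eqType) (k : nat) (e : seq T) :
  perm_eq (take k e ++ rev (drop k (drop k e)) ++ take k (drop k e)) e.
Proof.
rewrite -[X in perm_eq _ X](cat_take_drop k e) perm_cat2l perm_sym.
rewrite -[X in perm_eq X _](cat_take_drop k (drop k e)) perm_catC perm_cat2r.
by rewrite perm_sym perm_rev.
Qed.

Lemma min1n_ge (s : nat -> R) n k : (1 <= k <= n)%N -> min1n s n <= s k.
Proof.
move=> /andP[k1 kn]; rewrite /min1n; apply: (bigmin_inf_seq _ k) => //.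
by rewrite mem_index_iota k1 ltnS.
Qed.

Lemma max1n_le (s : nat -> R) n k : (1 <= k <= n)%N -> s k <= max1n s n.
Proof.
move=> /andP[k1 kn]; rewrite /max1n; apply: (le_bigmax_seq _ k) => //.
by rewrite mem_index_iota k1 ltnS.
Qed.

(** The change of variables is made on the positive and the negative parts. *)
Lemma fine_expectation_distribution d (T : measurableType d)
    (P : probability T R) (X : {RV P >-> int}) :
  fine 'E_P[fun w => (X w)%:~R] = mean (distribution P X).
Proof.
rewrite unlock /mean /Rintegral; congr fine.
rewrite [LHS]integralE [RHS]integralE; congr (_ - _)%E.
  rewrite (@ge0_integral_distribution _ _ _ _ _ P X (fun z : int => (z%:~R : R)%:E)^\+%E).
  - by apply: eq_integral => w _; rewrite /= !funeposE.
  - by [].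
  - by move=> z; exact: funepos_ge0.
rewrite (@ge0_integral_distribution _ _ _ _ _ P X (fun z : int => (z%:~R : R)%:E)^\-%E).
- by apply: eq_integral => w _; rewrite /= !funenegE.
- by [].
- by move=> z; exact: funeneg_ge0.
Qed.

Lemma third_bounds (n : nat) : (6 <= n)%N ->
  [/\ (2 <= n %/ 3)%N, (n <= 4 * (n %/ 3))%N & (2 * (n %/ 3) + n %/ 3 <= n)%N].
Proof. by move=> n6; split; lia. Qed.

End WalkOnLists.

Section Event.
Context {R : realType} {n : nat} (m : 'I_n -> R) (lam u v : R).
Let e := enum 'I_n.
Let g (i : 'I_n) (z : int) : R := z%:~R - m i.

Definition path_event (x : 'I_n -> int) : Prop :=
  let s k := u + \sum_(i < n | (i < k)%N) g i (x i) in
  [/\ 0 <= min1n s n, max1n s n <= lam & s n = v].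

Let e1 k := take k e.
Let e2 k := take k (drop k e).
Let e3 k := rev (drop k (drop k e)).

(** In the reversed last block the position after j steps is S_(n-j), seen from
    the end point v. *)
Lemma path_event_blocks (k : nat) (x : 'I_n -> int) :
  (0 < n)%N -> (0 < k)%N -> (2 * k <= n)%N -> path_event x ->
  [/\ stay lam g u (e1 k) (map x (e1 k)),
      stay lam (fun i z => - g i z) v (e3 k) (map x (e3 k)) &
      \sum_(z <- map x (e1 k ++ e3 k ++ e2 k)) z%:~R = v - u + \sum_i m i].
Proof.
move=> n0 k0 kn [hmin hmax hv].
pose s j := u + \sum_(i <- take j e) g i (x i).
have sE j : u + \sum_(i < n | (i < j)%N) g i (x i) = s j.
  by rewrite /s sum_ord_ltn.
have sb j : (1 <= j <= n)%N -> band lam (s j).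
  move=> jn; rewrite /band -sE.
  rewrite (le_trans hmin (min1n_ge (fun j => u + \sum_(i < n | (i < j)%N) g i (x i)) jn)) /=.
  exact: (le_trans (max1n_le (fun j => u + \sum_(i < n | (i < j)%N) g i (x i)) jn)).
have se : size e = n by rewrite size_enum_ord.
have sn : u + \sum_(i <- e) g i (x i) = v.
  by rewrite -hv sE /s take_oversize// se.
split.
- apply: stay_values => j; rewrite size_take_min se => /andP[j0 jk].
  rewrite /e1 take_takel; last by apply: leq_trans jk _; exact: geq_minl.
  by apply: sb; rewrite j0 (leq_trans jk)// geq_minr.
- apply: stay_values => j; rewrite /e3 size_rev !size_drop se => /andP[j0 jk].
  rewrite take_rev !drop_drop size_drop se.
  rewrite (perm_big _ (permEl (perm_rev _))) sumrN.
  have -> : (n - (k + k) - j + (k + k) = n - j)%N by lia.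
  have h : s (n - j)%N = v - \sum_(i <- drop (n - j) e) g i (x i).
    have hc : \sum_(i <- e) g i (x i) = \sum_(i <- take (n - j) e) g i (x i) +
        \sum_(i <- drop (n - j) e) g i (x i) by rewrite -big_cat cat_take_drop.
    by rewrite -sn hc /s; ring.
  rewrite -h; apply: sb; apply/andP; split; lia.
- rewrite big_map (perm_big e); last first.
    exact: perm_blocks.
  move: sn; rewrite /g sumrB => <-.
  by rewrite /e [\sum_(i <- enum _) m i]big_enum /=; ring.
Qed.

End Event.

(** * The theorem *)

Theorem lemma7p2 (R : realType) (c0 delta0 : R) (a : int -> R)
    (hc0 : 0 < c0) (hdelta0 : 0 < delta0)
    (ha01 : forall i, 0 <= a i <= 1)
    (ha : irreducible_aperiodic_seq a) :
  exists (c C lambda0 : R) (n0 : nat),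
    [/\ 0 < c, 0 < C, 0 <= lambda0 & (1 <= n0)%N] /\
    forall (n : nat) (lambda : R), (n0 <= n)%N ->
      lambda0 <= lambda -> lambda <= Num.sqrt n%:R ->
    forall (d : measure_display) (T : measurableType d) (P : probability T R)
      (X : 'I_n -> {RV P >-> int}),
      mutually_independent X ->
      (forall i, law_class a delta0 c0 (distribution P (X i))) ->
    forall u v : R, 0 <= u <= lambda -> 0 <= v <= lambda ->
      (P [set w | [/\ (0 <= min1n (fun k => centered_walk X u k w) n)%R,
                      (max1n (fun k => centered_walk X u k w) n <= lambda)%R
                    & centered_walk X u n w = v]]
       <= (C * (Num.min u (lambda - u) + 1) * (Num.min v (lambda - v) + 1)
             / lambda ^+ 3 * expR (- (c * n%:R / lambda ^+ 2)))%R%:E)%E.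
Proof.
have [i0 [j0 [ij ai0 aj0]]] := irreducible_seq_atoms ha01 ha.
pose eps := Num.min (a i0) (a j0).
have eps0 : 0 < eps by rewrite lt_min ai0.
have epsi : eps <= a i0 by rewrite ge_min lexx.
have epsj : eps <= a j0 by rewrite ge_min lexx orbT.
pose K := expR (delta0 * (2 * c0 / delta0)) * (2 * c0).
have K0 : 0 < K by rewrite mulr_gt0 ?expR_gt0// mulr_gt0.
have s20 : 0 < eps / 2 by rewrite divr_gt0.
have [Cs [cs [lam0 [[Cs0 cs0 l01] Hs]]]] := survival_uniform hdelta0 s20 K0.
have se0 : 0 < Num.sqrt eps by rewrite sqrtr_gt0.
exists (cs / 4), (Cs ^+ 2 * (2 / Num.sqrt eps)), lam0, 6%N; split.
  split => //; first by rewrite divr_gt0.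
    by rewrite mulr_gt0 ?exprn_gt0// divr_gt0.
  by apply: le_trans l01.
move=> n lam n6 ll ln d T P X indep laws u v ub vb.
pose p i := distribution P (X i).
pose m i := fine 'E_P[fun w => (X i w)%:~R].
pose g (i : 'I_n) (z : int) : R := z%:~R - m i.
have gg i : good_step delta0 (eps / 2) K (p i) (g i).
  rewrite /g /m fine_expectation_distribution.
  by have := law_class_good hdelta0 ij eps0 epsi epsj (laws i).
have gN i := good_stepN hdelta0 (gg i).
have [k2 k4 k3] := third_bounds n6.
set k := (n %/ 3)%N in k2 k4 k3.
have n0 : (0 < n)%N by apply: leq_trans n6.
have k0 : (0 < k)%N by apply: leq_trans k2.
have kn : (2 * k <= n)%N by apply: leq_trans k3; exact: leq_addr.
set e := enum 'I_n.
have sze : size e = n by rewrite size_enum_ord.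
pose ii1 := take k e; pose ii2 := take k (drop k e).
pose ii3 := rev (drop k (drop k e)).
have sz1 : size ii1 = k.
  by rewrite size_takel// sze (leq_trans _ kn)// leq_pmull.
have sz2 : size ii2 = k.
  by rewrite size_takel// size_drop sze leq_subRL ?addnn -?mul2n// (leq_trans _ kn)// leq_pmull.
have sz3 : (k <= size ii3)%N.
  by rewrite size_rev !size_drop sze -subnDA leq_subRL addnn -mul2n.
pose tot := v - u + \sum_i m i.
pose A (s : seq int) := [&& stay lam g u ii1 (take k s),
   stay lam (fun i z => - g i z) v ii3 (take (size ii3) (drop k s)) &
   \sum_(z <- s) z%:~R == tot].
pose o := ii1 ++ ii3 ++ ii2.
have uo : uniq o by rewrite (perm_uniq (perm_blocks k e)) enum_uniq.
set Ev := [set w | _].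
(* The event depends on the values of the variables only. *)
have EvE : Ev = [set w | path_event m lam u v (X^~ w)] by [].
have mEv : measurable Ev.
  rewrite EvE (_ : [set w | _] = [set w | path_event m lam u v
      (fun i => nth 0 [seq X i w | i <- e] (index i e))]).
    exact: (values_measurable X e (fun s => path_event m lam u v (fun i => nth 0 s (index i e)))).
  apply/seteqP; split => w /=; congr path_event; apply/funext => i;
    by rewrite (nth_map i) ?nth_index ?index_mem ?mem_enum.
have sub : Ev `<=` [set w | A [seq X i w | i <- o]].
  rewrite EvE => w /= /(path_event_blocks n0 k0 kn) [h1 h2 h3].
  rewrite /A h3 eqxx andbT /o map_cat.
  have -> : take k ([seq X i w | i <- ii1] ++ [seq X i w | i <- ii3 ++ ii2]) =
      [seq X i w | i <- ii1] by rewrite -sz1 -(size_map (X^~ w)) take_size_cat.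
  have -> : drop k ([seq X i w | i <- ii1] ++ [seq X i w | i <- ii3 ++ ii2]) =
      [seq X i w | i <- ii3 ++ ii2] by rewrite -sz1 -(size_map (X^~ w)) drop_size_cat.
  rewrite map_cat -(size_map (X^~ w)) take_size_cat//.
  by apply/andP; split.
apply: (@le_trans _ _ (P [set w | A [seq X i w | i <- o]])).
  apply: le_measure => //; rewrite inE//.
  exact: (values_measurable X o (fun s => A s)).
rewrite (prob_values indep (fun s => A s) uo) lee_fin.
have -> : (fun s => (`[< A s >])%:R) = (fun s => (A s)%:R) :> (seq int -> R).
  by apply/funext => s; rewrite asboolb.
have law1 i : eps <= fine (p i [set i0]) by apply: law_class_atom (laws i) epsi.
have law2 i : eps <= fine (p i [set j0]) by apply: law_class_atom (laws i) epsj.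
have conc2 := sum_concentration ij eps0 law1 law2 ii2.
set kap := 1 / Num.sqrt _ in conc2.
pose r (s1 s3 : seq int) : R := tot - \sum_(z <- s1) z%:~R - \sum_(z <- s3) z%:~R.
have := @iter_expect_three_blocks R 'I_n p ii1 ii2 ii3 A (stay lam g u ii1)
  (stay lam (fun i z => - g i z) v ii3) r kap _ conc2.
rewrite -/o => /(_ _) /le_trans; apply.
  move=> s1 s3 s2 h1 h3 /and3P[].
  rewrite -sz1 -h1 take_size_cat// drop_size_cat// -h3 take_size_cat//.
  move=> -> -> /eqP h; split => //.
  by rewrite /r -h !big_cat /=; ring.
have lam1 : 1 <= lam by apply: le_trans ll.
have lamp : 0 < lam by apply: lt_le_trans lam1.
have lamn : lam ^+ 2 <= n%:R.
  rewrite -[leRHS]sqr_sqrtr//; apply: lerXn2r => //; rewrite nnegrE ?sqrtr_ge0//.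
  exact: ltW.
have n4k : n%:R <= 4 * k%:R :> R by rewrite -natrM ler_nat.
have l2k : lam ^+ 2 <= 4 * k%:R by apply: le_trans n4k.
have lam2 : 0 < lam ^+ 2 by exact: exprn_gt0.
have b1 := Hs _ p g gg lam u ii1 ll ub.
rewrite sz1 in b1; move: (b1 k2 l2k) => {}b1.
have b3 := Hs _ p _ gN lam v ii3 ll vb (leq_trans k2 sz3).
have l2k3 : lam ^+ 2 <= 4 * (size ii3)%:R.
  by apply: le_trans l2k _; rewrite ler_pM2l// ler_nat.
move: (b3 l2k3) => {}b3.
(* k = n %/ 3 is at least n / 4 >= lam^2 / 4, as n >= 6 *)
have kap_le : kap <= 2 / Num.sqrt eps / lam.
  rewrite /kap sz2 -mulrA -invfM ler_pdivrMr ?sqrtr_gt0; last first.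
    by rewrite ltr_wpDl// mulr_ge0// ltW.
  rewrite mulrAC ler_pdivlMr ?mulr_gt0// mul1r.
  have -> : Num.sqrt eps * lam = Num.sqrt (eps * lam ^+ 2).
    by rewrite sqrtrM ?ltW// sqrtr_sqr gtr0_norm.
  have -> : 2 * Num.sqrt (eps * k%:R + 1) = Num.sqrt (4 * (eps * k%:R + 1)).
    have -> : 4 = 2 ^+ 2 :> R by rewrite -natrX.
    by rewrite sqrtrM ?sqr_ge0// sqrtr_sqr gtr0_norm.
  rewrite ler_wsqrtr//.
  have := ler_wpM2l (ltW eps0) l2k; lra.
have min0 (x : R) : 0 <= x <= lam -> 0 <= Num.min x (lam - x).
  by move=> /andP[x0 xl]; rewrite le_min x0 subr_ge0.
have mu0 := min0 u ub; have mv0 := min0 v vb.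
move: b1 b3; rewrite /survival.
have /andP[s10 _] := survival_bound p lam g u ii1; rewrite /survival in s10.
have /andP[s30 _] := survival_bound p lam (fun i z => - g i z) v ii3; rewrite /survival in s30.
move: s10 s30.
set S1 := iter_expect p ii1 _; set S3 := iter_expect p ii3 _ => s10 s30 b1 b3.
set mu := Num.min u (lam - u) in mu0 b1 *.
set mv := Num.min v (lam - v) in mv0 b3 *.
have e1 : expR (- (cs * k%:R / lam ^+ 2)) <= expR (- (cs / 4 * n%:R / lam ^+ 2)).
  apply: expR_le; rewrite lerN2; apply: ler_wpM2r; first by rewrite invr_ge0 ltW.
  rewrite -mulrA; apply: ler_wpM2l; first exact: ltW.
  by rewrite mulrC ler_pdivrMr// mulrC.
have e3 : expR (- (cs * (size ii3)%:R / lam ^+ 2)) <= 1.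
  rewrite expR_le1 oppr_le0; apply: divr_ge0; last exact: ltW.
  by apply: mulr_ge0 => //; exact: ltW.
have B1 : S1 <= Cs * (mu + 1) / lam * expR (- (cs / 4 * n%:R / lam ^+ 2)).
  apply: le_trans b1 _; apply: ler_wpM2l => //.
  by apply: divr_ge0; [apply: mulr_ge0; [exact: ltW|exact: addr_ge0]|exact: ltW].
have B3 : S3 <= Cs * (mv + 1) / lam.
  apply: le_trans b3 _; rewrite -[leRHS]mulr1; apply: ler_wpM2l => //.
  by apply: divr_ge0; [apply: mulr_ge0; [exact: ltW|exact: addr_ge0]|exact: ltW].
have kap0 : 0 <= kap by rewrite /kap divr_ge0// sqrtr_ge0.
apply: (@le_trans _ _ (2 / Num.sqrt eps / lam *
   (Cs * (mu + 1) / lam * expR (- (cs / 4 * n%:R / lam ^+ 2))) *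
   (Cs * (mv + 1) / lam))).
  apply: ler_pM => //; first exact: mulr_ge0.
  exact: ler_pM.
rewrite le_eqVlt; apply/orP; left; apply/eqP.
move: (expR _) => ex; field.
by rewrite !gt_eqF.
Qed.
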